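(* Let $\mathfrak g$ be a finite-dimensional complex simple Lie algebra, let $A$ be a commutative associative unital $\mathbb C$-algebra, and let $\mathbf B$ be a $\mathbb C$-basis of $A$ which is closed under multiplication. Let $\mathbf U_{\mathbb Z}(\mathfrak g\otimes A)$ be the $\mathbb Z$-subalgebra of $\mathbf U(\mathfrak g\otimes A)$ generated by $\{(x_\alpha^\pm\otimes b)^{(r)}:\alpha\in R^+,\ b\in\mathbf B,\ r\in\mathbb Z_{\ge0}\}$. Then $\mathbf U_{\mathbb Z}(\mathfrak g\otimes A)$ is an integral form for $\mathbf U(\mathfrak g\otimes A)$.
   Context: Fix a Cartan subalgebra of $\mathfrak g$, a set of simple roots $\{\alpha_i\}_{i\in I}$ with positive roots $R^+$, and a Chevalley basis $\{x_\alpha^\pm,h_i:\alpha\in R^+,i\in I\}$ of $\mathfrak g$, where $x_\alpha^\pm$ is the root vector of root $\pm\alpha$. $\mathfrak g\otimes A$ is the map algebra, with bracket $[z\otimes a,z'\otimes b]=[z,z']\otimes ab$; $\mathbf U(\cdot)$ is the universal enveloping algebra (over $\mathbb C$); $u^{(r)}=u^r/r!$. An integral form of an algebra $U$ over a field $\mathbb F$ of characteristic $0$ is a $\mathbb Z$-algebra $U_{\mathbb Z}$ such that $U_{\mathbb Z}\otimes_{\mathbb Z}\mathbb F=U$; for a $\mathbb Z$-subalgebra $U_{\mathbb Z}\subset U$ this means that the natural map $U_{\mathbb Z}\otimes_{\mathbb Z}\mathbb F\to U$, $u\otimes c\mapsto cu$, is an isomorphism. Here $\mathbb F=\mathbb C$.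 *)

(* Defs.v *)
From HB Require Import structures.
From mathcomp Require Import all_boot all_order all_algebra.
From mathcomp Require Import sesquilinear.
From mathcomp Require Import boolp classical_sets reals complex.

Set Implicit Arguments.
Unset Strict Implicit.
Unset Printing Implicit Defensive.

Import GRing.Theory.
Local Open Scope ring_scope.

HB.mixin Record Lmodule_isLie (K : fieldType) L of GRing.Lmodule K L := {
  lie : L -> L -> L;
  lie_is_bilinear : bilinear_for *:%R *:%R lie;
  liexx : forall x, lie x x = 0;
  lie_jacobi : forall x y z,
    lie x (lie y z) + lie y (lie z x) + lie z (lie x y) = 0
}.

#[short(type="lieType")]
HB.structure Definition Lie (K : fieldType) :=
  {L of Lmodule_isLie K L & GRing.Lmodule K L}.

#[short(type="finLieType")]
HB.structure Definition FinLie (K : fieldType) := {L of Lie K L & Vector K L}.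

Section FiniteDimensionalLie.
Variables (K : fieldType) (g : finLieType K).
Implicit Types (U V H : {vspace g}) (x y : g).

Definition ad x : 'End(g) := linfun (lie x).

(* [U, V], the span of all brackets of an element of U with one of V *)
Definition lie_prod U V : {vspace g} :=
  <<[seq lie u v | u <- vbasis U, v <- vbasis V]>>%VS.

Definition simple_lie : Prop :=
  lie_prod fullv fullv != 0%VS /\
  forall V, (lie_prod fullv V <= V)%VS -> V = 0%VS \/ V = fullv.

Definition nilpotent_lie H : Prop := exists n, iter n (lie_prod H) H = 0%VS.

Definition cartan_subalgebra H : Prop :=
  [/\ (lie_prod H H <= H)%VS, nilpotent_lie H &
      forall x, (forall y, y \in H -> lie x y \in H) -> x \in H].

Section Roots.
Variable H : {vspace g}.

Definition dual : vectType K := 'Hom(subvs_of H, K^o).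
Implicit Type a : dual.

(* { z | [y, z] = a(y) z for all y in H }; it suffices to let y run through
   a basis of H *)
Definition root_space a : {vspace g} :=
  (\bigcap_(y <- vbasis {:subvs_of H}) passmx.leigenspace (ad (vsval y)) (a y))%VS.

Definition is_root a : bool := (a != 0) && (root_space a != 0%VS).

(* t is the coroot h_a: the element of [g_a, g_(-a)] on which a takes the
   value 2 *)
Definition is_coroot a (t : g) : Prop :=
  [/\ t \in H, t \in lie_prod (root_space a) (root_space (- a)) &
      a (vsproj H t) = 2].

Variables (I : finType) (alpha : I -> dual).

Definition nonneg_comb a : Prop :=
  exists k : I -> nat, a = \sum_i alpha i *+ k i.

(* The roots span H^* over K, so a base of the root system is a K-basis of
   H^*. *)
Definition simple_roots : Prop :=
  [/\ forall i, is_root (alpha i),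
      basis_of fullv [seq alpha i | i : I] &
      forall a, is_root a -> nonneg_comb a \/ nonneg_comb (- a)].

Definition pos_root a : Prop := is_root a /\ nonneg_comb a.

(* Humphreys, Introduction to Lie Algebras and Representation Theory, 25.2.
   For a positive root a, x a is x_a^+ and x (- a) is x_a^-; the values of x
   outside the set of roots are irrelevant. *)
Record chevalley_basis (x : dual -> g) (h : I -> g) : Prop := {
  chev_root_vector : forall a, is_root a -> x a \in root_space a;
  chev_coroot : forall a, is_root a -> is_coroot a (lie (x a) (x (- a)));
  chev_simple_coroot : forall i, is_coroot (alpha i) (h i);
  chev_opp : forall a b, is_root a -> is_root b -> is_root (a + b) ->
    exists2 c : K, lie (x a) (x b) = c *: x (a + b) &
                   lie (x (- a)) (x (- b)) = - c *: x (- (a + b));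
  chev_basis : exists s : seq dual,
    [/\ uniq s, s =i is_root &
        basis_of fullv ([seq x a | a <- s] ++ [seq h i | i : I])]
}.

End Roots.
End FiniteDimensionalLie.

(* t : M x N -> P is a tensor product of the K-modules M and N *)
Definition is_tensor_product (K : comNzRingType) (M N P : lmodType K)
    (t : {bilinear M -> N -> P}) : Prop :=
  forall (Q : lmodType K) (f : {bilinear M -> N -> Q}),
  exists F : {linear P -> Q},
    (forall m n, F (t m n) = f m n) /\
    forall F' : {linear P -> Q}, (forall m n, F' (t m n) = f m n) -> F' =1 F.

(* L, with z (x) a := t z a, is the Lie algebra g (x) A *)
Definition is_map_algebra (K : fieldType) (g : lieType K) (A : comAlgType K)
    (L : lieType K) (t : {bilinear g -> A -> L}) : Prop :=
  is_tensor_product t /\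
  forall z z' a b, lie (t z a) (t z' b) = t (lie z z') (a * b).

Definition lie_to_assoc (K : fieldType) (L : lieType K) (U : algType K)
    (f : L -> U) : Prop :=
  forall x y, f (lie x y) = f x * f y - f y * f x.

Definition is_enveloping_algebra (K : fieldType) (L : lieType K)
    (U : algType K) (iota : {linear L -> U}) : Prop :=
  lie_to_assoc iota /\
  forall (V : algType K) (f : {linear L -> V}), lie_to_assoc f ->
  exists F : {lrmorphism U -> V},
    (forall x, F (iota x) = f x) /\
    forall F' : {lrmorphism U -> V}, (forall x, F' (iota x) = f x) -> F' =1 F.

Definition basis_set (K : fieldType) (A : lmodType K) (B : set A) : Prop :=
  (forall a, exists (s : seq A) (c : A -> K),
     (forall b, b \in s -> B b) /\ a = \sum_(b <- s) c b *: b) /\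
  (forall (s : seq A) (c : A -> K), uniq s -> (forall b, b \in s -> B b) ->
     \sum_(b <- s) c b *: b = 0 -> forall b, b \in s -> c b = 0).

Definition divided_power (K : fieldType) (U : algType K) (u : U) (r : nat) : U :=
  (r`!%:R)^-1 *: u ^+ r.

Section GeneratedSubring.
Variables (U : nzRingType) (G : set U).

Definition gen_subring : {pred U} :=
  fun u => `[< forall S : {pred U}, subring_closed S ->
                 (forall v, G v -> v \in S) -> u \in S >].

Lemma gen_subring_closed : subring_closed gen_subring.
Proof.
split.
- by apply/asboolP => S [].
- move=> u v /asboolP Hu /asboolP Hv; apply/asboolP => S cS GS.
  by case: (cS) => _ SB _; apply: SB; [exact: Hu|exact: Hv].
- move=> u v /asboolP Hu /asboolP Hv; apply/asboolP => S cS GS.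
  by case: (cS) => _ _ SM; apply: SM; [exact: Hu|exact: Hv].
Qed.

HB.instance Definition _ :=
  GRing.isSubringClosed.Build U gen_subring gen_subring_closed.

Definition gen_subring_type : Type := {u : U | u \in gen_subring}.
HB.instance Definition _ := [isSub of gen_subring_type for @sval _ _].
HB.instance Definition _ := [Choice of gen_subring_type by <:].
HB.instance Definition _ := [SubChoice_isSubNzRing of gen_subring_type by <:].

End GeneratedSubring.

(* The natural map UZ (x)_Z K -> U, u (x) c |-> c j(u), is an isomorphism;
   zmodule M is the abelian group M seen as a module over int. *)
Definition is_integral_form (K : fieldType) (U : algType K) (UZ : nzRingType)
    (j : {rmorphism UZ -> U}) : Prop :=
  exists (T : lmodType int) (t : {bilinear zmodule UZ -> zmodule K -> T})
         (phi : {additive T -> U}),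
    [/\ is_tensor_product t, forall u c, phi (t u c) = c *: j u &
        bijective phi].

(* the elements (x_a^+ (x) b)^(r) and (x_a^- (x) b)^(r) *)
Definition divided_power_generators (K : fieldType) (g : finLieType K)
    (H : {vspace g}) (I : finType) (alpha : I -> dual H) (x : dual H -> g)
    (A : comAlgType K) (B : set A) (L : lieType K) (t : g -> A -> L)
    (U : algType K) (iota : L -> U) : set U :=
  fun u => exists (a : dual H) (b : A) (r : nat),
    [/\ pos_root alpha a, B b &
        u = divided_power (iota (t (x a) b)) r \/
        u = divided_power (iota (t (x (- a)) b)) r].

(* Main.v *)
Require Import Defs.
From HB Require Import structures.
From mathcomp Require Import all_boot all_order all_algebra.
From mathcomp Require Import sesquilinear.
From mathcomp Require Import ring zify.
From mathcomp Require Import boolp classical_sets reals complex.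

(* Bijectivity of UZ (x)_Z C -> U is a rational statement: every divided power
   is a rational multiple of a power, so it suffices that the Chevalley basis
   tensored with B has rational structure constants.  No PBW theorem is needed.
   Given a biadditive f : UZ x C -> Q, the C-module M of all biadditive maps
   UZ x C -> Q carries a C-linear action of U in which each w in UZ acts by
   (w m)(v, d) = m(v w, d) (rationality of the structure constants makes the
   formula on the basis a Lie action), and u |-> (u f)(1, 1) is the map U -> Q
   induced by f; hence U itself, with w (x) c |-> c w, is the tensor product.

   For rationality of the structure constants, let <b, a> = b(h_a) and let
   [x_(-a), [x_a, x_b]] = q (r + 1) x_b with <b, a> = r - q.  The trace form
   gives 2 (h_a, y) = a(y) k_a with k_a = (h_a, h_a), and expanding
   [[x_a, x_b], [x_(-a), x_(-b)]] in two ways gives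
   c^2 k_(a+b) = q (r + 1) k_b when [x_a, x_b] = c x_(a+b).  A case analysis on
   Cartan integers yields (r + 1) k_(a+b) = q k_b, so c^2 = (r + 1)^2. *)

Set Implicit Arguments.
Unset Strict Implicit.
Unset Printing Implicit Defensive.

Import Order.TTheory GRing.Theory Num.Theory.
Local Open Scope ring_scope.

(** * Lie algebras *)

HB.instance Definition _ (K : fieldType) (L : lieType K) :=
  bilinear_isBilinear.Build K L L L _ _ lie lie_is_bilinear.
HB.instance Definition _ (K : fieldType) (L : lieType K) (x : L) :=
  GRing.isLinear.Build K L L *:%R (lie x) (lie_is_bilinear.2 x).

Section LieTheory.
Variables (K : fieldType) (L : lieType K).
Implicit Types (x y z : L).

Lemma lieDl x y z : lie (x + y) z = lie x z + lie y z.
Proof. exact: linearDl. Qed.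
Lemma lieDr x y z : lie x (y + z) = lie x y + lie x z.
Proof. exact: linearDr. Qed.
Lemma lieBr x y z : lie x (y - z) = lie x y - lie x z.
Proof. exact: linearBr. Qed.
Lemma lieZl c x y : lie (c *: x) y = c *: lie x y.
Proof. exact: linearZl_LR. Qed.
Lemma lieZr c x y : lie x (c *: y) = c *: lie x y.
Proof. exact: linearZr_LR. Qed.
Lemma lie0l x : lie 0 x = 0.
Proof. exact: linear0l. Qed.
Lemma lie0r x : lie x 0 = 0.
Proof. exact: linear0r. Qed.
Lemma lieNr x y : lie x (- y) = - lie x y.
Proof. exact: linearNr. Qed.

Lemma lieNl x y : lie (- x) y = - lie x y.
Proof. exact: linearNl. Qed.

Lemma lieC x y : lie x y = - lie y x.
Proof.
apply/eqP; rewrite -addr_eq0; apply/eqP.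
by have := liexx (x + y); rewrite lieDl !lieDr !liexx add0r addr0.
Qed.

Lemma lie_leibniz x y z : lie x (lie y z) = lie (lie x y) z + lie y (lie x z).
Proof.
have /eqP := lie_jacobi x y z; rewrite (lieC z x) lieNr (lieC z (lie x y)).
by rewrite -addrA -opprD subr_eq0 addrC => /eqP.
Qed.

Lemma lie_lie x y z : lie (lie x y) z = lie x (lie y z) - lie y (lie x z).
Proof. by rewrite [lie x (lie y z)]lie_leibniz addrK. Qed.

End LieTheory.

(** * Endomorphism algebras and modules of biadditive maps *)

(** An [algType] requires 1 != 0, so the proof that [M] is nonzero is a parameter of the type, from
    which the algebra instances can recover it. *)
Record endo (K : fieldType) (M : lmodType K) (M_neq0 : exists m : M, m != 0) :=
  Endo { endo_fun :> M -> M; endo_linear : linear endo_fun }.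

Section EndoAlgebra.
Variables (K : fieldType) (M : lmodType K) (M_neq0 : exists m : M, m != 0).
Local Notation E := (endo M_neq0).
Implicit Types (f g : E) (c : K) (m : M).

HB.instance Definition _ f := GRing.isLinear.Build K M M *:%R f (endo_linear f).

Lemma endoP f g : f =1 g -> f = g.
Proof.
case: f g => [f fL] [g gL] /= /funext fg.
by rewrite -{}fg in gL *; congr Endo; apply: Prop_irrelevance.
Qed.

HB.instance Definition _ := gen_eqMixin E.
HB.instance Definition _ := gen_choiceMixin E.

Fact endo_add_linear f g : linear (fun m => f m + g m).
Proof. by move=> c m n; rewrite !linearP scalerDr addrACA. Qed.
Fact endo_opp_linear f : linear (fun m => - f m).
Proof. by move=> c m n; rewrite linearP opprD scalerN. Qed.
Fact endo_zero_linear : linear (fun _ : M => 0 : M).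
Proof. by move=> c m n; rewrite scaler0 addr0. Qed.
Fact endo_one_linear : linear (fun m : M => m).
Proof. by []. Qed.
Fact endo_mul_linear f g : linear (fun m => f (g m)).
Proof. by move=> c m n; rewrite !linearP. Qed.
Fact endo_scale_linear c f : linear (fun m => c *: f m).
Proof. by move=> d m n; rewrite linearP scalerDr !scalerA mulrC. Qed.

Let add f g : E := Endo M_neq0 (endo_add_linear f g).
Let opp f : E := Endo M_neq0 (endo_opp_linear f).
Let zero : E := Endo M_neq0 endo_zero_linear.
Let one : E := Endo M_neq0 endo_one_linear.
Let mul f g : E := Endo M_neq0 (endo_mul_linear f g).
Let scale c f : E := Endo M_neq0 (endo_scale_linear c f).

Fact endo_addA : associative add.
Proof. by move=> f g k; apply: endoP => m /=; rewrite addrA. Qed.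
Fact endo_addC : commutative add.
Proof. by move=> f g; apply: endoP => m /=; rewrite addrC. Qed.
Fact endo_add0 : left_id zero add.
Proof. by move=> f; apply: endoP => m /=; rewrite add0r. Qed.
Fact endo_addN : left_inverse zero opp add.
Proof. by move=> f; apply: endoP => m /=; rewrite addNr. Qed.

HB.instance Definition _ :=
  GRing.isZmodule.Build E endo_addA endo_addC endo_add0 endo_addN.

Fact endo_mulA : associative mul.
Proof. by move=> f g k; apply: endoP. Qed.
Fact endo_mul1l : left_id one mul.
Proof. by move=> f; apply: endoP. Qed.
Fact endo_mul1r : right_id one mul.
Proof. by move=> f; apply: endoP. Qed.
Fact endo_mulDl : left_distributive mul +%R.
Proof. by move=> f g k; apply: endoP. Qed.
Fact endo_mulDr : right_distributive mul +%R.
Proof. by move=> f g k; apply: endoP => m /=; rewrite linearD. Qed.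
Fact endo_one_neq0 : one != 0.
Proof.
case: M_neq0 => m m0; apply: contraNneq m0 => E.
by have /(congr1 (fun f : endo _ => f m)) /= -> := E.
Qed.

HB.instance Definition _ := GRing.Zmodule_isNzRing.Build E
  endo_mulA endo_mul1l endo_mul1r endo_mulDl endo_mulDr endo_one_neq0.

Fact endo_scaleA c d f : scale c (scale d f) = scale (c * d) f.
Proof. by apply: endoP => m /=; rewrite scalerA. Qed.
Fact endo_scale1 : left_id 1 scale.
Proof. by move=> f; apply: endoP => m /=; rewrite scale1r. Qed.
Fact endo_scaleDr : right_distributive scale +%R.
Proof. by move=> c f g; apply: endoP => m /=; rewrite scalerDr. Qed.
Fact endo_scaleDl f : {morph scale^~ f : c d / c + d}.
Proof. by move=> c d; apply: endoP => m /=; rewrite scalerDl. Qed.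

HB.instance Definition _ := GRing.Zmodule_isLmodule.Build K E
  endo_scaleA endo_scale1 endo_scaleDr endo_scaleDl.

Fact endo_scaleAl c f g : c *: (f * g) = c *: f * g.
Proof. by apply: endoP. Qed.
HB.instance Definition _ := GRing.Lmodule_isLalgebra.Build K E endo_scaleAl.

Fact endo_scaleAr c f g : c *: (f * g) = f * (c *: g).
Proof. by apply: endoP => m; rewrite [RHS]/= /GRing.mul /= linearZ. Qed.
HB.instance Definition _ := GRing.Lalgebra_isAlgebra.Build K E endo_scaleAr.

Lemma endoDE f g m : (f + g) m = f m + g m. Proof. by []. Qed.
Lemma endoME f g m : (f * g) m = f (g m). Proof. by []. Qed.
Lemma endoZE c f m : (c *: f) m = c *: f m. Proof. by []. Qed.

End EndoAlgebra.

Record biadditive (W K Q : zmodType) := Biadditive {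
  biadd_fun :> W -> K -> Q;
  biaddDl : forall d, {morph biadd_fun^~ d : v w / v + w};
  biaddDr : forall w, {morph biadd_fun w : c d / c + d} }.

Section BiadditiveModule.
Variables (W : zmodType) (K : fieldType) (Q : zmodType).
Local Notation M := (biadditive W K Q).
Implicit Types (m n : M) (c d : K) (w : W).

Lemma biaddP m n : (forall w d, m w d = n w d) -> m = n.
Proof.
case: m n => [m ml mr] [n nl nr] /= mn.
have {}mn : m = n by apply: funext => w; apply: funext => d.
by rewrite -{}mn in nl nr *; congr Biadditive; apply: Prop_irrelevance.
Qed.

HB.instance Definition _ := gen_eqMixin M.
HB.instance Definition _ := gen_choiceMixin M.

Definition biadd_add m n : M.
Proof.
exists (fun w d => m w d + n w d) => [d v w|w c d] /=.
- by rewrite !biaddDl addrACA.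
- by rewrite !biaddDr addrACA.
Defined.

Definition biadd_opp m : M.
Proof.
exists (fun w d => - m w d) => [d v w|w c d] /=.
- by rewrite biaddDl opprD.
- by rewrite biaddDr opprD.
Defined.

Definition biadd_zero : M.
Proof.
exists (fun _ _ => 0 : Q) => [d v w|w c d] /=; by rewrite (addr0 (0 : Q)).
Defined.

(** [Q] is only an abelian group, so scalars act through the second argument. *)
Definition biadd_scale c m : M.
Proof.
exists (fun w d => m w (c * d)) => [d v w|w d e] /=.
- by rewrite biaddDl.
- by rewrite mulrDr biaddDr.
Defined.

Fact biadd_addA : associative biadd_add.
Proof. by move=> m n k; apply: biaddP => w d /=; rewrite addrA. Qed.
Fact biadd_addC : commutative biadd_add.
Proof. by move=> m n; apply: biaddP => w d /=; rewrite addrC. Qed.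
Fact biadd_add0 : left_id biadd_zero biadd_add.
Proof. by move=> m; apply: biaddP => w d /=; rewrite add0r. Qed.
Fact biadd_addN : left_inverse biadd_zero biadd_opp biadd_add.
Proof. by move=> m; apply: biaddP => w d /=; rewrite addNr. Qed.

HB.instance Definition _ :=
  GRing.isZmodule.Build M biadd_addA biadd_addC biadd_add0 biadd_addN.

Fact biadd_scaleA c d m :
  biadd_scale c (biadd_scale d m) = biadd_scale (c * d) m.
Proof. by apply: biaddP => w e /=; rewrite mulrA (mulrC c). Qed.
Fact biadd_scale1 : left_id 1 biadd_scale.
Proof. by move=> m; apply: biaddP => w d /=; rewrite mul1r. Qed.
Fact biadd_scaleDr : right_distributive biadd_scale +%R.
Proof. by move=> c m n; apply: biaddP. Qed.
Fact biadd_scaleDl m : {morph biadd_scale^~ m : c d / c + d}.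
Proof. by move=> c d; apply: biaddP => w e /=; rewrite mulrDl biaddDr. Qed.

HB.instance Definition _ := GRing.Zmodule_isLmodule.Build K M
  biadd_scaleA biadd_scale1 biadd_scaleDr biadd_scaleDl.

Lemma biaddDE m n w d : (m + n) w d = m w d + n w d. Proof. by []. Qed.
Lemma biaddZE c m w d : (c *: m) w d = m w (c * d). Proof. by []. Qed.

End BiadditiveModule.

Section RightTranslation.
Variables (W : pzRingType) (K : fieldType) (Q : zmodType).
Local Notation M := (biadditive W K Q).
Hypothesis M_neq0 : exists m : M, m != 0.

(** Right multiplication inside the argument is a left action: acting by w' and then by w gives m(v
    w w'). *)
Definition biadd_rmul (w : W) (m : M) : M.
Proof.
exists (fun v d => m (v * w) d) => [d u v|v c d] /=.
- by rewrite mulrDl biaddDl.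
- by rewrite biaddDr.
Defined.

Fact biadd_rmul_linear w : linear (biadd_rmul w).
Proof. by move=> c m n; apply: biaddP. Qed.

Definition rmul_endo w : endo M_neq0 := Endo M_neq0 (biadd_rmul_linear w).

Lemma rmul_endoE w m v d : rmul_endo w m v d = m (v * w) d. Proof. by []. Qed.

Fact rmul_endo_additive : zmod_morphism rmul_endo.
Proof.
have D : {morph rmul_endo : w w' / w + w'}.
  move=> w w'; apply: endoP => m; apply: biaddP => v d.
  by rewrite endoDE biaddDE !rmul_endoE mulrDr biaddDl.
by move=> w w'; apply: (addIr (rmul_endo w')); rewrite -D !subrK.
Qed.
HB.instance Definition _ :=
  GRing.isZmodMorphism.Build W (endo M_neq0) rmul_endo rmul_endo_additive.

Fact rmul_endo_multiplicative : monoid_morphism rmul_endo.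
Proof.
split=> [|w w']; apply: endoP => m; apply: biaddP => v d.
  by rewrite rmul_endoE mulr1.
by rewrite endoME !rmul_endoE mulrA.
Qed.
HB.instance Definition _ :=
  GRing.isMonoidMorphism.Build W (endo M_neq0) rmul_endo
    rmul_endo_multiplicative.

End RightTranslation.

(** * Tensor products and enveloping algebras *)

Section BilinearComp.
Variables (K : comNzRingType) (M N P Q : lmodType K).
Variables (t : {bilinear M -> N -> P}) (G : {linear P -> Q}).

Definition bilinear_comp m n := G (t m n).
Fact bilinear_comp_subproof : bilinear_for *:%R *:%R bilinear_comp.
Proof.
split=> [n c m m'|m c n n']; rewrite /bilinear_comp.
  by rewrite linearPl linearP.
by rewrite linearPr linearP.
Qed.
HB.instance Definition _ := bilinear_isBilinear.Build K M N Q _ _ bilinear_comp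
  bilinear_comp_subproof.

End BilinearComp.

(** Both maps factor the same bilinear map [bilinear_comp t G2], so the uniqueness clause
    applies. *)
Lemma tensor_linear_ext (K : comNzRingType) (M N P Q : lmodType K)
    (t : {bilinear M -> N -> P}) (G1 G2 : {linear P -> Q}) :
  is_tensor_product t -> (forall m n, G1 (t m n) = G2 (t m n)) -> G1 =1 G2.
Proof.
move=> /(_ Q (bilinear_comp t G2)) [F [_ F_uniq]] eqG y.
by rewrite (F_uniq G1) // (F_uniq G2).
Qed.

(** * Linear extension from a basis given as a set *)

Section BasisExtension.
Variables (K : fieldType) (A W : lmodType K) (B : set A) (g : A -> W).
Hypothesis B_basis : basis_set B.

Lemma big_count_mem (V : nmodType) (s r : seq A) (F : A -> V) :
  uniq r -> {subset s <= r} ->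
  \sum_(b <- s) F b = \sum_(b <- r) F b *+ count_mem b s.
Proof.
move=> r_uniq; elim: s => [|a s IHs] sub /=.
  by rewrite big_nil big1.
have a_r : a \in r by apply: sub; rewrite mem_head.
rewrite big_cons IHs; last by move=> b bs; apply: sub; rewrite inE bs orbT.
under [RHS]eq_bigr do rewrite mulrnDr.
rewrite big_split /=; congr (_ + _).
rewrite (bigD1_seq a) //= eqxx big1 ?addr0 // => b /negPf ba.
by rewrite eq_sym ba.
Qed.

(** The list supplied by [basis_set] may repeat elements. Weighting each coefficient by its
    multiplicity gives coordinates valid on every duplicate-free list containing the support. *)
Lemma basis_set_coord (a : A) : exists sc : seq A * (A -> K),
  [/\ forall b, b \in sc.1 -> B b, forall b, b \notin sc.1 -> sc.2 b = 0 &
      forall u, uniq u -> {subset sc.1 <= u} -> a = \sum_(b <- u) sc.2 b *: b].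
Proof.
have [s [c [sB ->]]] := B_basis.1 a.
exists (s, fun b => c b *+ count_mem b s); split=> //= [b|u u_uniq su].
  by move=> /count_memPn->.
rewrite (big_count_mem _ u_uniq su).
by apply: eq_bigr => b _; rewrite scalerMnl.
Qed.

(** Linearity is checked on one finite list [u] containing the supports of all vectors involved;
    there independence identifies the coefficients. *)
Lemma basis_set_linear_ext :
  exists F : {linear A -> W}, forall b, B b -> F b = g b.
Proof.
have [sc scP] := boolp.choice basis_set_coord.
pose s a := (sc a).1; pose c a := (sc a).2.
have sB a b : b \in s a -> B b by have [+ _ _] := scP a; apply.
have c0 a b : b \notin s a -> c a b = 0 by have [_ + _] := scP a; apply.
have cE a u : uniq u -> {subset s a <= u} -> a = \sum_(b <- u) c a b *: b.
  by have [_ _] := scP a; apply.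
pose F a := \sum_(b <- undup (s a)) c a b *: g b.
have FE a u : uniq u -> {subset s a <= u} -> F a = \sum_(b <- u) c a b *: g b.
  move=> u_uniq su; rewrite /F (big_count_mem _ u_uniq); last first.
    by move=> b; rewrite mem_undup => /su.
  apply: eq_bigr => b _; rewrite count_uniq_mem ?undup_uniq // mem_undup.
  by have [//|/c0->] := boolP (b \in s a); rewrite scale0r.
have indep u (d e : A -> K) : uniq u -> (forall b, b \in u -> B b) ->
    \sum_(b <- u) d b *: b = \sum_(b <- u) e b *: b ->
    \sum_(b <- u) d b *: g b = \sum_(b <- u) e b *: g b.
  move=> u_uniq uB /eqP; rewrite -subr_eq0 -sumrB => /eqP sum0.
  apply: eq_big_seq => b bu; congr (_ *: _); apply/eqP; rewrite -subr_eq0.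
  apply/eqP; apply: (B_basis.2 u (fun b => d b - e b)) => //.
  by under eq_bigr do rewrite scalerBl.
have F_linear : linear F.
  move=> k a a'.
  pose u := undup (s a ++ s a' ++ s (k *: a + a')).
  have uB b : b \in u -> B b.
    by rewrite mem_undup !mem_cat => /or3P[] /sB.
  have u_uniq : uniq u := undup_uniq _.
  have [s1 s2 s3] : [/\ {subset s a <= u}, {subset s a' <= u} &
      {subset s (k *: a + a') <= u}].
    by split=> b; rewrite mem_undup !mem_cat => ->; rewrite ?orbT.
  have sumE (V : lmodType K) (G : A -> V) :
      k *: (\sum_(b <- u) c a b *: G b) + \sum_(b <- u) c a' b *: G b =
      \sum_(b <- u) (k * c a b + c a' b) *: G b.
    rewrite scaler_sumr -big_split; apply: eq_bigr => b _.
    by rewrite scalerDl scalerA.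
  rewrite !(FE _ u) // sumE; apply: indep => //.
  by rewrite -(sumE A id) -!cE.
pose FL : {linear A -> W} :=
  HB.pack F (GRing.isLinear.Build K A W _ F F_linear).
exists FL => b Bb; pose u := undup (b :: s b).
have bu : b \in u by rewrite mem_undup mem_head.
have sumE (V : lmodType K) (G : A -> V) :
    \sum_(b' <- u) (b' == b)%:R *: G b' = G b.
  rewrite (bigD1_seq b) ?undup_uniq //= eqxx scale1r big1 ?addr0 // => b'.
  by move=> /negPf->; rewrite scale0r.
have su : {subset s b <= u} by move=> b'; rewrite mem_undup inE orbC => ->.
rewrite /= (FE b u) ?undup_uniq // -(sumE _ g).
apply: indep; rewrite ?undup_uniq //; last by rewrite sumE -cE ?undup_uniq.
by move=> b'; rewrite mem_undup inE => /predU1P[->|/sB].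
Qed.

End BasisExtension.

(** * Spanning statements derived from universal properties *)

Section SubmoduleType.
Variables (K : fieldType) (V : lmodType K) (S : {pred V}).
Hypothesis S_closed : submod_closed S.

(** The closure proof is an argument so that instance inference can read it off the term. *)
Definition submod_pred (_ : submod_closed S) : {pred V} := S.
HB.instance Definition _ := GRing.isSubmodClosed.Build K V
  (submod_pred S_closed) S_closed.

Definition submod_type := {v : V | v \in submod_pred S_closed}.
HB.instance Definition _ := [isSub of submod_type for @sval _ _].
HB.instance Definition _ := [Choice of submod_type by <:].
HB.instance Definition _ := [SubChoice_isSubLmodule of submod_type by <:].

End SubmoduleType.

Section SubalgebraType.
Variables (K : fieldType) (V : algType K) (S : {pred V}).
Hypothesis S_closed : subalg_closed S.

Definition subalg_pred (_ : subalg_closed S) : {pred V} := S.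
HB.instance Definition _ := GRing.isSubalgClosed.Build K V
  (subalg_pred S_closed) S_closed.

Definition subalg_type := {v : V | v \in subalg_pred S_closed}.
HB.instance Definition _ := [isSub of subalg_type for @sval _ _].
HB.instance Definition _ := [Choice of subalg_type by <:].
HB.instance Definition _ := [SubChoice_isSubAlgebra of subalg_type by <:].

(** A named inclusion carrying both the ring morphism and the linear structure, so that it composes
    with an [lrmorphism]. *)
Definition subalg_val : subalg_type -> V := val.
HB.instance Definition _ := GRing.RMorphism.copy subalg_val
  (val : subalg_type -> V).
HB.instance Definition _ := GRing.Linear.copy subalg_val
  (val : subalg_type -> V).

End SubalgebraType.

(** Corestrict [t] to [S]. The induced map into [S], followed by the inclusion, is the identity by
    uniqueness, so every element lies in [S]. *)
Lemma tensor_product_span (K : fieldType) (M N P : lmodType K)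
    (t : {bilinear M -> N -> P}) (S : {pred P}) :
  is_tensor_product t -> submod_closed S -> (forall m n, t m n \in S) ->
  forall y, y \in S.
Proof.
move=> tP S_closed tS y.
pose s m n : submod_type S_closed := exist _ (t m n) (tS m n).
have s_bil : bilinear_for *:%R *:%R s.
  by split=> [n|m] c u v; apply: val_inj; rewrite linearP /= ?linearPl ?linearPr.
pose sB : {bilinear M -> N -> submod_type S_closed} :=
  HB.pack s (bilinear_isBilinear.Build K M N _ _ _ s s_bil).
have [F [FE _]] := tP _ sB.
have valF : val \o F =1 idfun.
  by apply: (tensor_linear_ext tP) => m n /=; rewrite FE.
by have := valP (F y); rewrite -[y in X in _ -> X]valF.
Qed.

(** The corestriction argument again, now with the universal property of the enveloping algebra. *)
Lemma enveloping_algebra_span (K : fieldType) (L : lieType K) (U : algType K)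
    (iota : {linear L -> U}) (S : {pred U}) :
  is_enveloping_algebra iota -> subalg_closed S -> (forall l, iota l \in S) ->
  forall u, u \in S.
Proof.
move=> [iota_lie iotaP] S_closed iotaS u.
pose f l : subalg_type S_closed := exist _ (iota l) (iotaS l).
have f_lin : linear f.
  by move=> c l l'; apply: val_inj; rewrite linearP /= linearP.
pose fL : {linear L -> subalg_type S_closed} :=
  HB.pack f (GRing.isLinear.Build K L _ _ f f_lin).
have [|F [FE _]] := iotaP _ fL.
  by move=> l l'; apply: val_inj; rewrite /= iota_lie.
have [G [_ G_uniq]] := iotaP U iota iota_lie.
have valF : @subalg_val _ _ _ S_closed \o F =1 idfun.
  move=> v; transitivity (G v); last by symmetry; apply: G_uniq.
  by apply: G_uniq => l /=; rewrite FE.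
by have := valP (F u); rewrite -[u in X in _ -> X]valF.
Qed.

(** Clearing denominators by [D] turns the relation into an integral one. It holds in [W] because
    [j] is injective; apply [p] and divide by [D]. *)
Lemma rational_combination (K : numFieldType) (W : zmodType) (V V' : lmodType K)
    (j : {additive W -> V}) (p : {additive W -> V'}) (n : nat)
    (q : 'I_n -> rat) (w : W) (z : 'I_n -> W) :
  injective j -> j w = \sum_k ratr (q k) *: j (z k) ->
  p w = \sum_k ratr (q k) *: p (z k).
Proof.
move=> j_inj jw.
pose D := \prod_k denq (q k).
pose N k := numq (q k) * \prod_(i | i != k) denq (q i).
have D_neq0 : D%:~R != 0 :> K.
  by rewrite intr_eq0; apply/prodf_neq0 => k _; apply: denq_neq0.
have qE k : D%:~R * ratr (q k) = (N k)%:~R :> K.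
  rewrite /D (bigD1 k) //= !intrM mulrAC; congr (_ * _).
  by rewrite /ratr mulrC divfK // intr_eq0 denq_neq0.
have sumE (X : lmodType K) (e : {additive W -> X}) :
    D%:~R *: (\sum_k ratr (q k) *: e (z k)) = e (\sum_k z k *~ N k).
  rewrite scaler_sumr raddf_sum; apply: eq_bigr => k _.
  by rewrite scalerA qE scaler_int raddfMz.
apply: (scalerI D_neq0); rewrite sumE scaler_int -raddfMz; congr (p _).
by apply: j_inj; rewrite -sumE -jw scaler_int raddfMz.
Qed.

(* B need not contain 1, but expanding 1 in B shows that b = b1 b for some b1. *)
Lemma basis_set_factor (K : fieldType) (A : comAlgType K) (B : set A) (b : A) :
  basis_set B -> (forall a a', B a -> B a' -> B (a * a')) -> B b ->
  exists b1 b2, [/\ B b1, B b2 & b = b1 * b2].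
Proof.
move=> B_basis B_mul Bb.
(* [F] is the coordinate at b. If a b != b for every a occurring in 1, then F(b) = F(1 b) = 0,
   whereas F(b) = 1. *)
have [F FE] := basis_set_linear_ext (fun a => (a == b)%:R : K^o) B_basis.
have [s [c [sB oneE]]] := B_basis.1 1.
suff /hasP[a /sB Ba /eqP abE] : has (fun a => a * b == b) s.
  by exists a, b; rewrite abE.
apply: contraT => /hasPn no_fix; have : F b = 0.
  rewrite -[b]mul1r oneE mulr_suml linear_sum big_seq big1 // => a a_s /=.
  rewrite -scalerAl linearZ /= FE; last exact: B_mul (sB _ a_s) Bb.
  by rewrite (negPf (no_fix a a_s)) scaler0.
by move/eqP; rewrite FE // eqxx oner_eq0.
Qed.

(** * The integral form, given a basis of [g] with rational structure constants *)

Section Descent.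
Variables (K : numFieldType) (g : finLieType K) (n : nat) (X : n.-tuple g).
Hypothesis X_basis : basis_of fullv X.
Hypothesis X_rational :
  forall i j k : 'I_n, exists q : rat, coord X k (lie X`_i X`_j) = ratr q.
Variables (A : comAlgType K) (B : set A).
Hypothesis B_basis : basis_set B.
Hypothesis B_mul : forall a b : A, B a -> B b -> B (a * b).
Variables (L : lieType K) (t : {bilinear g -> A -> L}).
Hypothesis L_map : is_map_algebra t.
Variables (U : algType K) (iota : {linear L -> U}).
Hypothesis U_env : is_enveloping_algebra iota.
Variable G : set U.
Hypothesis XG :
  forall (i : 'I_n) b, B b -> iota (t X`_i b) \in gen_subring G.
Hypothesis GX : forall u, G u -> exists (i : 'I_n) b r,
  B b /\ u = divided_power (iota (t X`_i b)) r.

Local Notation UZ := (gen_subring_type G).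
Local Notation j := (val : UZ -> U).

(** The default 1 is never reached for b in [B], by [XG]. *)
Definition basis_gen (i : 'I_n) (b : A) : UZ := insubd 1 (iota (t X`_i b)).

Lemma val_basis_gen i b : B b -> j (basis_gen i b) = iota (t X`_i b).
Proof. by move=> /(XG i) Xb; rewrite insubdK. Qed.

Lemma map_algebra_span (S : {pred L}) :
  submod_closed S -> (forall (i : 'I_n) b, B b -> t X`_i b \in S) ->
  forall l, l \in S.
Proof.
move=> S_closed tS; apply: (tensor_product_span L_map.1 S_closed) => z a.
change (t z a \in submod_pred S_closed).
rewrite (coord_basis X_basis (memvf z)) linear_sumlz rpred_sum // => i _.
rewrite linearZl_LR rpredZ //; have [s [c [sB ->]]] := B_basis.1 a.
rewrite linear_sumr big_seq rpred_sum // => b /sB Bb.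
by rewrite linearZr_LR rpredZ //; apply: tS.
Qed.

(* [t z a |-> p (basis_gen)], extended K-linearly from the bases, is a map of
   Lie algebras because the structure constants are rational. *)
Lemma basis_gen_lift (V : algType K) (p : {rmorphism UZ -> V}) :
  exists F : {lrmorphism U -> V}, forall w : UZ, F (j w) = p w.
Proof.
have /boolp.choice[e eE] : forall i : 'I_n, exists F : {linear A -> V},
    forall b, B b -> F b = p (basis_gen i b).
  by move=> i; apply: basis_set_linear_ext.
pose s z a := \sum_(i < n) coord X i z *: e i a.
have s_bil : bilinear_for *:%R *:%R s.
  split=> [a c z z'|z c a a']; rewrite /= /s scaler_sumr -big_split /=;
    apply: eq_bigr => i _.
    by rewrite linearP scalerDl scalerA.
  by rewrite linearP scalerDr !scalerA mulrC.
pose sB : {bilinear g -> A -> V} :=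
  HB.pack s (bilinear_isBilinear.Build K g A _ _ _ s s_bil).
have [f [fE _]] := L_map.1 V sB.
have Xfree := basis_free X_basis.
have fX (i : 'I_n) b : B b -> f (t X`_i b) = p (basis_gen i b).
  move=> Bb; rewrite fE /= /s (bigD1 i) //= coord_free // eqxx scale1r.
  rewrite big1 ?addr0 ?eE // => k /negPf ki.
  by rewrite coord_free // eq_sym ki scale0r.
have lieE := L_map.2.
have f_lieX (i k : 'I_n) b c : B b -> B c ->
    f (lie (t X`_i b) (t X`_k c)) =
    f (t X`_i b) * f (t X`_k c) - f (t X`_k c) * f (t X`_i b).
  move=> Bb Bc; rewrite !fX // -!rmorphM -rmorphB lieE.
  have /boolp.choice[q qE] := X_rational i k.
  have Bbc := B_mul Bb Bc.
  have cE : lie X`_i X`_k = \sum_(l < n) ratr (q l) *: X`_l.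
    rewrite [LHS](coord_basis X_basis) ?memvf //.
    by apply: eq_bigr => l _; rewrite qE.
  rewrite [in LHS]cE linear_sumlz linear_sum /=.
  under eq_bigr do rewrite linearZl_LR linearZ fX //=.
  (* The commutator relation is known in [U], after applying [j]; its rational coefficients allow it
     to be transported along [p]. *)
  apply/esym/(@rational_combination K UZ U V j p) => //; first exact: val_inj.
  transitivity (j (basis_gen i b) * j (basis_gen k c) -
    j (basis_gen k c) * j (basis_gen i b)); first by [].
  rewrite !val_basis_gen // -U_env.1 lieE cE.
  rewrite linear_sumlz linear_sum /=; apply: eq_bigr => l _.
  by rewrite linearZl_LR linearZ val_basis_gen.
(* The identity is linear in each argument, so it is reduced to the spanning tensors one argument at
   a time. *)
have f_lie : lie_to_assoc f.
  move=> l l'.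
  pose S (v : L) := `[< forall l', f (lie v l') = f v * f l' - f l' * f v >].
  suff /(_ l)/asboolP : forall v, v \in (S : {pred L}) by apply.
  apply: map_algebra_span.
    split=> [|c u v /asboolP uS /asboolP vS].
      by apply/asboolP => v; rewrite lie0l linear0 mul0r mulr0 subr0.
    apply/asboolP => w; rewrite lieDl lieZl !linearP /= uS vS.
    by rewrite mulrDl mulrDr -!scalerAl -!scalerAr scalerBr opprD addrACA.
  move=> i b Bb; apply/asboolP => v.
  pose S' (v : L) := f (lie (t X`_i b) v) ==
    f (t X`_i b) * f v - f v * f (t X`_i b).
  apply/eqP; change (v \in (S' : {pred L})); move: v.
  apply: map_algebra_span.
    split=> [|c u v /eqP uS /eqP vS].
      by rewrite /in_mem /= /S' lie0r linear0 mul0r mulr0 subr0.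
    rewrite /in_mem /= /S' lieDr lieZr !linearP /= uS vS.
    by rewrite mulrDl mulrDr -!scalerAl -!scalerAr scalerBr opprD addrACA.
  by move=> k c Bc; rewrite /in_mem /= /S' f_lieX.
have [F [FE _]] := U_env.2 V f f_lie.
exists F => w.
(* The elements where [F] agrees with [p] form a subring, so only the divided powers in [G] remain
   to be checked. *)
pose S (u : U) := `[< exists2 w : UZ, j w = u & F u = p w >].
suff /asboolP[w' /val_inj -> //] : j w \in (S : {pred U}).
have /asboolP := valP w; apply=> [|u Gu].
  split=> [|u v /asboolP[u' <- uE] /asboolP[v' <- vE]|
      u v /asboolP[u' <- uE] /asboolP[v' <- vE]]; apply/asboolP.
  - by exists 1; rewrite // !rmorph1.
  - by exists (u' - v') => //; rewrite !rmorphB /= uE vE.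
  - by exists (u' * v') => //; rewrite !rmorphM /= uE vE.
have Gu' : u \in gen_subring G by apply/asboolP => S' _; apply.
have [i [b [r [Bb uE]]]] := GX Gu.
apply/asboolP; exists (Sub u Gu'); first by rewrite SubK.
have r_neq0 : r`!%:R != 0 :> K by rewrite pnatr_eq0 -lt0n fact_gt0.
have wE : Sub u Gu' *+ r`! = basis_gen i b ^+ r :> UZ.
  apply: val_inj; rewrite raddfMn.
  transitivity (j (basis_gen i b) ^+ r); last by rewrite -(rmorphXn j).
  rewrite val_basis_gen //= uE.
  by rewrite /divided_power -scaler_nat scalerA divff // scale1r.
have := congr1 p wE; rewrite rmorphMn rmorphXn => pwE.
apply: (scalerI r_neq0); rewrite [RHS]scaler_nat pwE.
rewrite uE /divided_power linearZ /= scalerA divff // scale1r.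
by rewrite -fX // -FE -rmorphXn.
Qed.

(** The K-span of [UZ] is a subalgebra containing the image of [iota], hence is all of [U]. This
    yields uniqueness in the tensor property. *)
Lemma gen_subring_span (u : U) :
  exists s : seq (K * UZ), u = \sum_(cw <- s) cw.1 *: j cw.2.
Proof.
pose S (u : U) :=
  `[< exists s : seq (K * UZ), u = \sum_(cw <- s) cw.1 *: j cw.2 >].
have S_closed : subalg_closed (S : {pred U}).
  split=> [|c _ _ /asboolP[s ->] /asboolP[s' ->]|
      _ _ /asboolP[s ->] /asboolP[s' ->]]; apply/asboolP.
  - by exists [:: (1, 1)]; rewrite big_seq1 scale1r.
  - exists ([seq (c * cw.1, cw.2) | cw <- s] ++ s').
    rewrite big_cat big_map /=; congr (_ + _).
    by rewrite scaler_sumr; apply: eq_bigr => cw _; rewrite scalerA.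
  - exists [seq (cw.1 * cw'.1, cw.2 * cw'.2) | cw <- s, cw' <- s'].
    rewrite big_allpairs_dep /= big_distrl; apply: eq_bigr => cw _ /=.
    rewrite big_distrr; apply: eq_bigr => cw' _ /=.
    by rewrite -scalerAl -scalerAr scalerA.
suff /asboolP : u \in (S : {pred U}) by [].
apply: (enveloping_algebra_span U_env S_closed) => l.
pose S' := [pred l | iota l \in (S : {pred U})].
change (l \in S'); apply: map_algebra_span.
  have [_ S_lin _] := S_closed.
  have S0 : 0 \in (S : {pred U}) := rpred0 (subalg_pred S_closed).
  split=> [|c v w vS wS]; first by rewrite /in_mem /= linear0.
  by rewrite /in_mem /= linearP; apply: S_lin.
move=> i b Bb; apply/asboolP.
by exists [:: (1, basis_gen i b)]; rewrite big_seq1 scale1r val_basis_gen.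
Qed.

Definition scaled_val (w : zmodule UZ) (c : zmodule K) : zmodule U := c *: j w.

Fact scaled_val_bilinear : bilinear_for *:%R *:%R scaled_val.
Proof.
have Dl (k : int) (w w' : UZ) (c : K) :
    c *: j (w *~ k + w') = (c *: j w) *~ k + c *: j w'.
  have -> : j (w *~ k + w') = j w *~ k + j w' by rewrite raddfD raddfMz.
  by rewrite scalerDr -!scaler_int !scalerA mulrC.
have Dr (k : int) (w : UZ) (c d : K) :
    (c *~ k + d) *: j w = (c *: j w) *~ k + d *: j w.
  by rewrite scalerDl -mulrzl -scalerA scaler_int.
by split=> [c k w w'|w k c d]; [apply: Dl|apply: Dr].
Qed.

HB.instance Definition _ := bilinear_isBilinear.Build int _ _ _ _ _ scaled_val
  scaled_val_bilinear.

Lemma scaled_val_tensor : is_tensor_product scaled_val.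
Proof.
move=> Q f.
pose M := biadditive UZ K Q.
pose m0 : M := @Biadditive UZ K Q f (fun d v w => linearDl f d v w)
  (fun w c d => linearDr f w c d).
have f_uniq (F : {linear zmodule U -> Q}) :
    (forall w c, F (scaled_val w c) = f w c) ->
  forall F' : {linear zmodule U -> Q},
    (forall w c, F' (scaled_val w c) = f w c) -> F' =1 F.
  move=> FE F' F'E u; have [s ->] := gen_subring_span u.
  rewrite (raddf_sum F) (raddf_sum F'); apply: eq_bigr => cw _.
  by rewrite [LHS]F'E [RHS]FE.
suff [F FE] : exists F : {linear zmodule U -> Q},
  forall w c, F (scaled_val w c) = f w c by exists F; split=> //; apply: f_uniq.
(* If [M] is zero it has no endomorphism algebra, but then f = 0 and the zero map factors it. *)
have [M_neq0|M_eq0] := pselect (exists m : M, m != 0); last first.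
  have m0_eq0 : m0 = 0.
    by apply: contrapT => /eqP m0_neq0; case: M_eq0; exists m0.
  exists (\0 : {linear zmodule U -> Q}) => w c /=.
  by have := congr1 (fun m : M => m w c) m0_eq0.
have [F FE] := basis_gen_lift (rmul_endo M_neq0).
(* On u = c j(w) this is m0(1 w, c 1) = f(w, c): w acts by right translation and c by scaling the
   second argument. *)
pose h (u : U) : Q := F u m0 1 1.
have h_add : zmod_morphism h.
  move=> u v; rewrite /h raddfB; apply/eqP; rewrite eq_sym subr_eq.
  by rewrite -biaddDE -endoDE subrK.
pose hA : {additive U -> Q} :=
  HB.pack h (GRing.isZmodMorphism.Build U Q h h_add).
have h_lin : linear (h : zmodule U -> Q).
  move=> k u v; rewrite -[k in RHS]intz scaler_int -(raddfMz hA).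
  exact: (raddfD hA).
pose hL : {linear zmodule U -> Q} :=
  HB.pack (h : zmodule U -> Q)
    (GRing.isLinear.Build int (zmodule U) Q _ h h_lin).
exists hL => w c; rewrite /= /h /scaled_val.
have -> : F (c *: j w) = c *: rmul_endo M_neq0 w by rewrite -FE linearZ.
by rewrite endoZE biaddZE rmul_endoE mul1r mulr1.
Qed.

Theorem integral_form_of_rational_basis : is_integral_form j.
Proof.
pose phi : {additive zmodule U -> U} := (idfun : U -> U).
exists (zmodule U), scaled_val, phi; split=> //.
- exact: scaled_val_tensor.
- by exists id.
Qed.

End Descent.

(** * Rationality of the structure constants of a Chevalley basis *)

Section LieSubspaces.
Variables (K : fieldType) (g : finLieType K).
Implicit Types (U V W : {vspace g}) (u v : g).

Lemma adE u v : ad u v = lie u v.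
Proof. by rewrite /ad lfunE. Qed.

Lemma memv_bigcap_seq (T : Type) (s : seq T) (F : T -> {vspace g}) v :
  (v \in \bigcap_(i <- s) F i)%VS = all (fun i => v \in F i) s.
Proof.
by elim: s => [|i s IHs]; rewrite ?big_nil ?memvf // big_cons memv_cap IHs.
Qed.

Lemma lie_prod_sub U V W : (forall u v, u \in U -> v \in V -> lie u v \in W) ->
  (lie_prod U V <= W)%VS.
Proof.
move=> UVW; apply/span_subvP => _ /allpairsP[[u v] [/= uU vV ->]].
by apply: UVW; apply: vbasis_mem.
Qed.

Section Weights.
Variable H : {vspace g}.

(** Composing with the projection onto [H] gives a linear form on all of [g], which avoids coercions
    to [subvs_of H]; its value matters only for y in [H]. *)
Definition weight_at (a : dual H) (y : g) : K := a (vsproj H y).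

Lemma weight_atD a b y : weight_at (a + b) y = weight_at a y + weight_at b y.
Proof. by rewrite /weight_at add_lfunE. Qed.
Lemma weight_atN a y : weight_at (- a) y = - weight_at a y.
Proof. by rewrite /weight_at opp_lfunE. Qed.
Lemma weight_at0 y : weight_at 0 y = 0.
Proof. by rewrite /weight_at zero_lfunE. Qed.
Lemma weight_atMn a n y : weight_at (a *+ n) y = weight_at a y *+ n.
Proof.
by elim: n => [|n IHn]; rewrite ?weight_at0 // !mulrS weight_atD IHn.
Qed.
Lemma weight_atZ c a y : weight_at (c *: a) y = c * weight_at a y.
Proof. by rewrite /weight_at scale_lfunE. Qed.

Fact weight_at_linear a : linear (weight_at a : g -> K^o).
Proof. by move=> c y z; rewrite /weight_at !linearP. Qed.
HB.instance Definition _ a :=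
  GRing.isLinear.Build K g K^o _ (weight_at a) (weight_at_linear a).

Lemma weight_at_scale a c y : weight_at a (c *: y) = c * weight_at a y.
Proof. by rewrite /weight_at !linearZ. Qed.

Lemma weight_at_sumr (J : finType) a (F : J -> g) :
  weight_at a (\sum_j F j) = \sum_j weight_at a (F j).
Proof. exact: (linear_sum (weight_at a)). Qed.

Lemma weight_at_suml (J : finType) (F : J -> dual H) y :
  weight_at (\sum_j F j) y = \sum_j weight_at (F j) y.
Proof. by rewrite /weight_at sum_lfunE. Qed.

Lemma weight_at_inj a b :
  {in H, forall y, weight_at a y = weight_at b y} -> a = b.
Proof.
move=> ab; apply/lfunP => y; have := ab _ (subvsP y).
by rewrite /weight_at vsvalK.
Qed.

(** The eigenvector equation is linear in y, so it passes from a basis of [H] to all of [H]. *)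
Lemma root_spaceP a v :
  reflect {in H, forall y, lie y v = weight_at a y *: v} (v \in root_space a).
Proof.
have E y : y \in H -> (v \in passmx.leigenspace (ad y) (weight_at a y)) =
    (lie y v == weight_at a y *: v).
  move=> yH; rewrite /passmx.leigenspace memv_ker add_lfunE opp_lfunE.
  by rewrite scale_lfunE id_lfunE adE subr_eq0.
have -> : (v \in root_space a) = all (fun y =>
    lie (vsval y) v == weight_at a (vsval y) *: v) (vbasis {:subvs_of H}).
  rewrite /root_space memv_bigcap_seq; apply: eq_all => y /=.
  by rewrite -E ?subvsP // /weight_at vsvalK.
apply: (iffP allP) => [lie_v y yH|lie_v y _]; last by rewrite lie_v ?subvsP.
rewrite -(vsprojK yH); move: (vsproj H y) => {yH}y.
rewrite (coord_vbasis (memvf y)) !linear_sum linear_sumlz scaler_suml /=.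
apply: eq_bigr => i _; rewrite lieZl weight_at_scale -scalerA.
by congr (_ *: _); apply/eqP/lie_v/mem_nth; rewrite size_tuple.
Qed.

Lemma lie_weight a v y :
  v \in root_space a -> y \in H -> lie y v = weight_at a y *: v.
Proof. by move=> /root_spaceP va /va. Qed.

End Weights.
End LieSubspaces.

(** * Arithmetic of Cartan integers *)

Lemma int_factor4 (m n : int) : n * m = 4 ->
  m = 4 \/ m = 2 \/ m = 1 \/ m = -1 \/ m = -2 \/ m = -4.
Proof.
move=> nm4; have [m_le le_m] : m <= 4 /\ -4 <= m.
  have : n <= -1 \/ n = 0 \/ 1 <= n by lia.
  by case=> [|[|]] Hn; split; nia.
have : m = 4 \/ m = 3 \/ m = 2 \/ m = 1 \/ m = 0 \/ m = -1 \/ m = -2 \/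
  m = -3 \/ m = -4 by lia.
do !case=> [E|]; rewrite ?E in nm4 *; lia.
Qed.

(* To be read with m = <b, a>, n = <a, b>, u = <a, a + b>, v = <b, a + b>, and
   P, ka, kb the norms of the coroots of a + b, a, b. *)
Lemma string_length_int (r q : nat) (m n u v P ka kb : int) :
  0 < P -> 0 < ka -> 0 < kb -> m = r%:Z - q%:Z -> (0 < q)%N -> m + 2 * q%:Z <= 3 ->
  n * ka = m * kb -> (2 + m) * P = u * ka -> (n + 2) * P = v * kb ->
  u + v = 2 -> n * m < 4 -> u * (2 + m) < 4 ->
  r.+1%:Z * P = q%:Z * kb.
Proof.
move=> P0 ka0 kb0 mE q0 le3 nm uE vE uv nm4 um4.
(* The equations for u and v, multiplied by kb and ka and added; u + v = 2 eliminates both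
   unknowns. *)
have L : (2 + m) * P * kb + (n + 2) * P * ka = 2 * ka * kb.
  by rewrite uE vE -uv; ring.
have cancel (a b c : int) : 0 < c -> c * a = c * b -> a = b.
  by move=> c0; apply: mulfI; rewrite gt_eqF.
have m1 : m = -1 -> P = kb.
  move=> m1; apply: (cancel _ _ (2 * ka)); first by lia.
  rewrite m1 in nm L.
  have <- : (2 + -1) * P * kb + (n + 2) * P * ka = 2 * ka * P.
    have -> : (2 + -1) * P * kb + (n + 2) * P * ka =
      P * kb + P * (n * ka) + 2 * ka * P by ring.
    by rewrite nm; ring.
  by rewrite L.
(* Since m + 2q = r + q <= 3 and q > 0, six pairs remain. The two with m = -1 follow from [m1]. *)
have : (q = 1 /\ r = 0 \/ q = 1 /\ r = 1 \/ q = 1 /\ r = 2 \/ q = 2 /\ r = 0 \/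
  q = 2 /\ r = 1 \/ q = 3 /\ r = 0)%N by lia.
case=> [|[|[|[|[|]]]]] [qE rE].
- by rewrite m1 ?qE ?rE // mE qE rE.
- have {}mE : m = 0 by lia.
  rewrite mE addr0 in uE um4 nm; have u1 : u = 1 by nia.
  have n0 : n = 0 by nia.
  have {}L : ka * (kb + ka) = ka * (2 * kb).
    by rewrite -{1}[ka]mul1r -u1 -uE; rewrite mE n0 in L; lia.
  have := cancel _ _ _ ka0 L; rewrite qE rE; lia.
- have {}mE : m = 1 by lia.
  rewrite mE in uE um4 nm L; have u1 : u = 1 by nia.
  rewrite u1 in uE; have kaE : ka = 3 * P by lia.
  have {}L : P * (2 * ka) = P * (2 * kb).
    by rewrite kaE in nm L *; nia.
  have := cancel _ _ _ P0 L; rewrite qE rE; lia.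
- have {}mE : m = -2 by lia.
  rewrite mE in uE um4 nm nm4 L; have n1 : n = -1 by nia.
  rewrite n1 in nm L; have kaE : ka = 2 * kb by lia.
  have {}L : ka * P = ka * (2 * kb) by lia.
  have := cancel _ _ _ ka0 L; rewrite qE rE; lia.
- by rewrite m1 ?qE ?rE // mE qE rE.
- have {}mE : m = -3 by lia.
  rewrite mE in uE um4 nm nm4 L; have n1 : n = -1 by nia.
  rewrite n1 in nm L; have kaE : ka = 3 * kb by lia.
  have {}L : kb * (2 * P) = kb * (6 * kb) by rewrite kaE in L; lia.
  have := cancel _ _ _ kb0 L; rewrite qE rE; lia.
Qed.

(** * Root spaces and coroots *)

Section ChevalleyBasis.
Variables (K : numFieldType) (g : finLieType K) (H : {vspace g}).
Variables (I : finType) (alpha : I -> dual H).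
Hypothesis alpha_simple : simple_roots alpha.
Variables (x : dual H -> g) (h : I -> g).
Hypothesis xh_chevalley : chevalley_basis alpha x h.
Variable s : seq (dual H).
Hypotheses (s_uniq : uniq s) (sE : s =i @is_root K g H).
Hypothesis xh_basis : basis_of fullv ([seq x a | a <- s] ++ [seq h i | i : I]).
Implicit Types (a b : dual H) (u v y : g).

Local Notation xhs := ([seq x a | a <- s] ++ [seq h i | i : I]).
Local Notation wt := (@weight_at K g H).

Lemma mem_roots a : (a \in s) = is_root a.
Proof. exact: sE. Qed.

Lemma root_neq0 a : is_root a -> a != 0.
Proof. by case/andP. Qed.

Lemma lie_root_space a b u v :
  u \in root_space a -> v \in root_space b -> lie u v \in root_space (a + b).
Proof.
move=> ua vb; apply/root_spaceP => y yH.
by rewrite lie_leibniz (lie_weight ua yH) lieZl (lie_weight vb yH) lieZr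
  weight_atD scalerDl.
Qed.

(** A coroot lies in [g_a, g_(-a)], which has weight 0. *)
Lemma cartan_coroot_comm a t y : is_coroot a t -> y \in H -> lie y t = 0.
Proof.
move=> [_ t_in _] yH.
have t0 : t \in root_space (0 : dual H).
  apply: subvP t_in; apply: lie_prod_sub => u v uU vV.
  by rewrite -(subrr a) lie_root_space.
by rewrite (lie_weight t0 yH) weight_at0 scale0r.
Qed.

Lemma coroot_in a t : is_coroot a t -> t \in H.
Proof. by case. Qed.

Lemma h_free : free [seq h i | i : I].
Proof. by have := basis_free xh_basis; rewrite cat_free => /and3P[]. Qed.

Lemma dim_cartan : \dim H = #|I|.
Proof.
have [_ /andP[/eqP alpha_span alpha_free] _] := alpha_simple.
have := eqP alpha_free; rewrite alpha_span dimvf size_map -cardE => <-.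
by rewrite /dual /dim /= muln1.
Qed.

(** The [h i] are independent elements of [H], and their number is dim H because the simple roots
    form a basis of the dual. *)
Lemma cartan_span : H = <<[seq h i | i : I]>>%VS.
Proof.
apply/eqP; rewrite eq_sym eqEdim; apply/andP; split.
  apply/span_subvP => _ /mapP[i _ ->].
  exact: coroot_in (chev_simple_coroot xh_chevalley i).
by rewrite dim_cartan (eqP h_free) size_map -cardE.
Qed.

Lemma cartan_abelian y i : y \in H -> lie y (h i) = 0.
Proof. exact: cartan_coroot_comm (chev_simple_coroot xh_chevalley i). Qed.

Local Notation N := (size xhs).
Local Notation X := (in_tuple xhs).

Let X_basis : basis_of fullv X := xh_basis.
Let X_free : free X := basis_free xh_basis.

Definition basis_weights : seq (dual H) := s ++ nseq #|I| 0.

Lemma size_basis_weights : size basis_weights = size xhs.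
Proof. by rewrite !size_cat size_map size_nseq size_image. Qed.

Lemma basis_weight (j : 'I_(size xhs)) : X`_j \in root_space basis_weights`_j.
Proof.
rewrite /= !nth_cat size_map; case: ltnP => [js|sj].
  rewrite (nth_map 0) //; apply: chev_root_vector xh_chevalley _ _.
  by rewrite -mem_roots mem_nth.
set k := (j - _)%N; have kI : (k < size [seq h i | i : I])%N.
  by rewrite ltn_subLR // (leq_trans (ltn_ord j)) // size_cat size_map.
have /mapP[i _ ->] := mem_nth 0 kI.
rewrite nth_nseq if_same; apply/root_spaceP => y yH.
by rewrite cartan_abelian // weight_at0 scale0r.
Qed.

Lemma lie_cartan_basis y (j : 'I_(size xhs)) :
  y \in H -> lie y X`_j = wt basis_weights`_j y *: X`_j.
Proof. exact: lie_weight (basis_weight j). Qed.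

(** Compare the j-th coordinates of [y, v] = a(y) v and cancel the nonzero coordinate of v. *)
Lemma coord_weight a v (j : 'I_(size xhs)) :
  v \in root_space a -> coord X j v != 0 -> basis_weights`_j = a.
Proof.
move=> va cj; apply: weight_at_inj => y yH.
have vE := coord_basis X_basis (memvf v).
have := lie_weight va yH; rewrite {1 2}vE linear_sum /=.
under eq_bigr => k _ do rewrite lieZr lie_cartan_basis // scalerA.
move=> /(congr1 (coord X j)).
rewrite coord_sum_free // linearZ /=.
rewrite coord_sum_free // mulrC.
by move/(mulIf cj).
Qed.

(** Only [x a] has weight a in the basis: [s] has no repetition and the [h i] have weight 0. *)
Lemma root_space_line a v : is_root a -> v \in root_space a ->
  exists c, v = c *: x a.
Proof.
move=> a_root va; have a_s : a \in s by rewrite mem_roots.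
have ja : (index a s < size xhs)%N.
  by rewrite size_cat size_map ltn_addr // index_mem.
have XjE : xhs`_(index a s) = x a.
  by rewrite nth_cat size_map index_mem a_s (nth_map 0) ?index_mem // nth_index.
exists (coord X (Ordinal ja) v).
rewrite [LHS](coord_basis X_basis (memvf v)) (bigD1 (Ordinal ja)) //=.
rewrite XjE big1 ?addr0 // => j j_neq.
have [->|cj] := eqVneq (coord X j v) 0; first by rewrite scale0r.
case/negP: j_neq; apply/eqP/val_inj => /=.
have := coord_weight va cj; rewrite nth_cat; case: ltnP => [js <-|_].
  by rewrite index_uniq.
by rewrite nth_nseq if_same => a0; have := root_neq0 a_root; rewrite -a0 eqxx.
Qed.

(** If g_(-a) vanished, so would [g_a, g_(-a)], which contains an element where a takes the value
    2. *)
Lemma root_opp a : is_root a -> is_root (- a).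
Proof.
move=> a_root; rewrite /is_root oppr_eq0 root_neq0 //=.
have [_ t_in t2] := chev_coroot xh_chevalley a_root.
apply: contraPneq t2 => ra0.
have : lie (x a) (x (- a)) \in (0 : {vspace g})%VS.
  apply: subvP t_in; apply: lie_prod_sub => u v uU.
  by rewrite ra0 memv0 => /eqP->; rewrite lie0r mem0v.
rewrite memv0 => /eqP->; rewrite !linear0 => /eqP.
by rewrite eq_sym pnatr_eq0.
Qed.

Definition coroot a := lie (x a) (x (- a)).

Lemma corootP a : is_root a -> is_coroot a (coroot a).
Proof. exact: (chev_coroot xh_chevalley). Qed.

Lemma coroot_H a : is_root a -> coroot a \in H.
Proof. by move/corootP => []. Qed.

Lemma corootN a : coroot (- a) = - coroot a.
Proof. by rewrite /coroot opprK lieC. Qed.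

Lemma coroot2 a : is_root a -> wt a (coroot a) = 2.
Proof. by move/corootP => []. Qed.

Lemma x_root a : is_root a -> x a \in root_space a.
Proof. exact: (chev_root_vector xh_chevalley). Qed.

(** The space [g_a, g_(-a)] lies in the line of [coroot a], and the value 2 fixes the multiple. *)
Lemma coroot_uniq a t : is_root a -> is_coroot a t -> t = coroot a.
Proof.
move=> a_root [_ t_in t2].
have /vlineP[c tE] : t \in <[coroot a]>%VS.
  apply: subvP t_in; apply: lie_prod_sub => u v.
  move=> /(root_space_line a_root)[c ->].
  move=> /(root_space_line (root_opp a_root))[d ->].
  by rewrite lieZl lieZr !memvZ // memv_line.
move: t2; rewrite -/(wt a t) tE weight_at_scale coroot2 // => c2.
have /eqP : (c - 1) * 2 = 0 by rewrite mulrBl c2 mul1r subrr.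
by rewrite mulf_eq0 pnatr_eq0 orbF subr_eq0 => /eqP->; rewrite scale1r.
Qed.

Lemma h_coroot i : h i = coroot (alpha i).
Proof.
apply: coroot_uniq; last exact: (chev_simple_coroot xh_chevalley).
by have [+ _ _] := alpha_simple; apply.
Qed.

Lemma root_space_neq0 a v :
  v \in root_space a -> v != 0 -> a != 0 -> is_root a.
Proof.
move=> va v0 a0; rewrite /is_root a0; apply: contraNneq v0 => ra0.
by move: va; rewrite ra0 memv0.
Qed.

Lemma x_neq0 a : is_root a -> x a != 0.
Proof.
move=> /coroot2; apply: contra_eq_neq => xa0.
by rewrite /coroot xa0 lie0l linear0 eq_sym pnatr_eq0.
Qed.

(** * Root strings *)

Lemma iter_root_space a b k : is_root a -> is_root b ->
  iter k (lie (x a)) (x b) \in root_space (b + a *+ k).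
Proof.
move=> a_root b_root; elim: k => [|k IHk]; first by rewrite addr0 x_root.
by rewrite iterS mulrS addrCA; apply: lie_root_space IHk; apply: x_root.
Qed.

Lemma root_string_finite a b : is_root a -> is_root b ->
  exists k, iter k (lie (x a)) (x b) == 0.
Proof.
move=> a_root b_root; pose e k := iter k (lie (x a)) (x b).
have e_in k : e k \in root_space (b + a *+ k) by apply: iter_root_space.
apply: contrapT => /forallNP e_neq0.
(* These weights are distinct at [coroot a], and each is 0 or a root: one more than [0 :: s] can
   hold. *)
pose r := [seq b + a *+ k | k <- iota 0 (size s).+2].
suff : (size r <= size (0%R :: s))%N by rewrite size_map size_iota ltnn.
apply: uniq_leq_size => [|_ /mapP[k _ ->]].
  rewrite map_inj_uniq ?iota_uniq // => k l /addrI.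
  move=> /(congr1 (fun c => wt c (coroot a))).
  rewrite !weight_atMn coroot2 // -!mulrnA => /eqP.
  by rewrite eqr_nat eqn_mul2l => /eqP.
rewrite inE; case: eqVneq => //= bak0; rewrite mem_roots.
by apply: root_space_neq0 (e_in k) _ bak0; apply/negP/e_neq0.
Qed.

(** The sl2 computation: with e_k = ad(x_a)^k x_b, the bracket [x_(-a), e_(k+1)] is c - (m k + k (k
    + 1)) times e_k. Here q is the last index with e_q nonzero, and e_(q+1) = 0 determines c. *)
Lemma root_string_up a b : is_root a -> is_root b ->
  exists q, [/\ b + a *+ q = 0 \/ is_root (b + a *+ q) &
    lie (x (- a)) (lie (x a) (x b)) =
      (wt b (coroot a) *+ q + (q * q.+1)%:R) *: x b].
Proof.
move=> a_root b_root; pose e k := iter k (lie (x a)) (x b).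
have e_in k : e k \in root_space (b + a *+ k) by apply: iter_root_space.
have [c cE] : exists c, lie (x (- a)) (lie (x a) (x b)) = c *: x b.
  apply: (root_space_line b_root).
  have := lie_root_space (x_root (root_opp a_root))
    (lie_root_space (x_root a_root) (x_root b_root)).
  by rewrite addKr.
pose m := wt b (coroot a).
have eS k : e k.+1 = lie (x a) (e k) by [].
have fe k : lie (x (- a)) (e k.+1) = (c - (m *+ k + (k * k.+1)%:R)) *: e k.
  elim: k => [|k IHk]; first by rewrite mulr0n addr0 subr0.
  rewrite [in LHS]eS lie_leibniz IHk lieZr -eS [lie _ (x a)]lieC lieNl.
  rewrite (lie_weight (e_in _) (coroot_H a_root)) weight_atD weight_atMn.
  rewrite coroot2 // -scaleNr -scalerDl -/m; congr (_ *: _).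
  ring.
have := root_string_finite a_root b_root; rewrite -/(e _) => e_eq0.
case: (ex_minnP e_eq0) => -[|q] /eqP eq0 q_min.
  by have := x_neq0 b_root; rewrite -eq0 eqxx.
have eq_neq0 : e q != 0.
  by apply: contraTneq (ltnSn q) => /eqP/q_min; rewrite -leqNgt.
exists q; split.
  have [->|n0] := eqVneq (b + a *+ q) 0; [by left|right].
  exact: root_space_neq0 (e_in q) eq_neq0 n0.
rewrite cE; congr (_ *: _); apply/eqP; rewrite -subr_eq0.
have /eqP := fe q; rewrite /e eq0 lie0r eq_sym scaler_eq0 (negPf eq_neq0) orbF.
by [].
Qed.

(** Apply [root_string_up] to a and to -a. The two scalars differ by the action m of the coroot, so
    (r - q - m)(r + q + 1) = 0 and m = r - q. *)
Lemma root_string a b : is_root a -> is_root b -> exists r q : nat,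
  [/\ wt b (coroot a) = r%:R - q%:R, is_root (b + a *+ q),
      lie (x (- a)) (lie (x a) (x b)) = (q * r.+1)%:R *: x b &
      lie (x a) (lie (x (- a)) (x b)) = (r * q.+1)%:R *: x b].
Proof.
move=> a_root b_root; have [q [q_root qE]] := root_string_up a_root b_root.
have [r [_ rE]] := root_string_up (root_opp a_root) b_root.
rewrite opprK in rE; pose m := wt b (coroot a).
have wN : wt b (coroot (- a)) = - m.
  by rewrite corootN -scaleN1r weight_at_scale mulN1r.
have comm : lie (x a) (lie (x (- a)) (x b)) -
    lie (x (- a)) (lie (x a) (x b)) = m *: x b.
  by rewrite lie_leibniz addrK (lie_weight (x_root b_root) (coroot_H a_root)).
have m_eq : m = r%:R - q%:R.
  move: comm; rewrite rE qE wN -/m -scalerBl => /eqP.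
  rewrite -subr_eq0 -scalerBl scaler_eq0 (negPf (x_neq0 b_root)) orbF => /eqP E.
  have /eqP : (r%:R - q%:R - m) * (r + q + 1)%:R = 0.
    by rewrite -[RHS]E; ring.
  by rewrite mulf_eq0 pnatr_eq0 addn1 orbF subr_eq0 => /eqP.
exists r, q; split; first exact: m_eq.
(* If b + q a = 0, evaluation at the coroot gives r + q = 0, so q = 0 and b = 0, which is not a
   root. *)
- case: q_root => [top0|]; last by [].
  have := congr1 (wt^~ (coroot a)) top0.
  rewrite /= weight_atD weight_atMn (coroot2 a_root) weight_at0 -/m m_eq => /eqP.
  have -> : r%:R - q%:R + 2 *+ q = (r + q)%:R :> K by ring.
  rewrite pnatr_eq0 addn_eq0 => /andP[_ /eqP q0].
  move: top0; rewrite q0 mulr0n addr0 => b0.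
  by case/eqP: (root_neq0 b_root).
- by rewrite qE -/m m_eq; congr (_ *: _); ring.
- by rewrite rE wN m_eq; congr (_ *: _); ring.
Qed.

(** ad x_(-a) sends x_(2a) into the line of x_a, which ad x_a kills. Hence r = 0 and the pairing is
    -q, but it equals 4. *)
Lemma root_double a : is_root a -> ~~ is_root (a *+ 2).
Proof.
move=> a_root; apply/negP => a2_root.
have [r [q [m_eq _ _]]] := root_string a_root a2_root.
have [|c ->] := root_space_line (v := lie (x (- a)) (x (a *+ 2))) a_root.
  have := lie_root_space (x_root (root_opp a_root)) (x_root a2_root).
  by rewrite mulr2n addKr.
rewrite lieZr liexx scaler0 => /esym/eqP.
rewrite scaler_eq0 (negPf (x_neq0 a2_root)) orbF pnatr_eq0 muln_eq0 orbF.
move=> /eqP r0.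
move: m_eq; rewrite r0 weight_atMn coroot2 // sub0r => /eqP.
by rewrite -subr_eq0 opprK -mulrnA -natrD pnatr_eq0.
Qed.

(** * The Killing form and Cartan integers *)

Definition kappa y z : K := \sum_(i < N) coord X i (lie y (lie z X`_i)).

(** [kappa] is the trace of ad y ad z in the basis [X]. The claim reduces to tr(f1 f2) = tr(f2 f1)
    with f1 = ad v and f2 = ad u ad w. *)
Lemma kappa_invariant u v w : kappa (lie u v) w = kappa u (lie v w).
Proof.
have trC (f1 f2 : {linear g -> g}) :
    \sum_(i < N) coord X i (f1 (f2 X`_i)) = \sum_(i < N) coord X i (f2 (f1 X`_i)).
  have E (f1' f2' : {linear g -> g}) : \sum_(i < N) coord X i (f1' (f2' X`_i)) =
      \sum_(i < N) \sum_(j < N) coord X j (f2' X`_i) * coord X i (f1' X`_j).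
    apply: eq_bigr => i _; rewrite {1}[f2' _](coord_basis X_basis (memvf _)).
    by rewrite !linear_sum; apply: eq_bigr => j _; rewrite !linearZ.
  rewrite !E exchange_big; apply: eq_bigr => i _; apply: eq_bigr => j _.
  exact: mulrC.
pose uw : {linear g -> g} := lie u \o lie w.
have := trC (lie v) uw; rewrite /= => trE.
apply/eqP; rewrite -subr_eq0 -sumrB; apply/eqP.
transitivity (\sum_(i < N) (coord X i (lie u (lie w (lie v X`_i))) -
  coord X i (lie v (lie u (lie w X`_i))))); last first.
  by rewrite sumrB -trE subrr.
apply: eq_bigr => i _; rewrite -!linearB /=; congr (coord X i _).
by rewrite !lie_lie lieBr opprB addrC addrA subrK.
Qed.

Lemma kappa_cartan y z : y \in H -> z \in H ->
  kappa y z = \sum_(b <- s) wt b y * wt b z.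
Proof.
move=> yH zH; transitivity (\sum_(b <- basis_weights) wt b y * wt b z); last first.
  rewrite big_cat /= [X in _ + X]big1_seq ?addr0 // => b.
  by rewrite mem_nseq => /and3P[_ _ /eqP->]; rewrite !weight_at0 mul0r.
rewrite (big_nth 0) big_mkord size_basis_weights; apply: eq_bigr => i _.
rewrite lie_cartan_basis // lieZr lie_cartan_basis // scalerA linearZ /=.
by rewrite coord_free // eqxx mulr1 mulrC.
Qed.

Lemma kappaZr y c z : kappa y (c *: z) = c * kappa y z.
Proof.
rewrite mulr_sumr; apply: eq_bigr => i _.
by rewrite lieZl lieZr linearZ.
Qed.

Definition cartan_int b a : int :=
  xget 0 [set z | wt b (coroot a) = z%:~R]%classic.

Lemma cartan_intE a b : is_root a -> is_root b ->
  wt b (coroot a) = (cartan_int b a)%:~R.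
Proof.
move=> a_root b_root; rewrite /cartan_int; case: xgetP => [z -> //|no_int].
have [r [q [E _ _ _]]] := root_string a_root b_root.
by case: (no_int (r%:Z - q%:Z)); rewrite /= E rmorphB.
Qed.

(** For a root this is the Killing norm of [coroot a], kept as an integer so that it can be
    ordered. *)
Definition coroot_norm a : int := \sum_(c <- s) cartan_int c a ^+ 2.

Lemma kappa_coroot a b : is_root a -> is_root b ->
  kappa (coroot a) (coroot b) =
    (\sum_(c <- s) cartan_int c a * cartan_int c b)%:~R.
Proof.
move=> a_root b_root; rewrite kappa_cartan ?coroot_H // rmorph_sum /=.
apply: eq_big_seq => c; rewrite mem_roots => c_root.
by rewrite !cartan_intE // rmorphM.
Qed.

(** Invariance gives (h_a, y) = a(y) (x_a, x_(-a)); taking y = h_a identifies the constant as half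
    the norm. *)
Lemma kappa_coroot_l a y : is_root a -> y \in H ->
  2 * kappa (coroot a) y = wt a y * (coroot_norm a)%:~R.
Proof.
move=> a_root; pose k := kappa (x a) (x (- a)).
have kE z : z \in H -> kappa (coroot a) z = wt a z * k.
  move=> zH; rewrite kappa_invariant lieC.
  rewrite (lie_weight (x_root (root_opp a_root)) zH) weight_atN scaleNr opprK.
  exact: kappaZr.
have -> : (coroot_norm a)%:~R = 2 * k.
  by rewrite -(coroot2 a_root) -kE ?coroot_H // kappa_coroot.
by move=> /kE ->; ring.
Qed.

Lemma cartan_int_diag a : is_root a -> cartan_int a a = 2.
Proof.
move=> a_root; apply: (intr_inj (R := K)).
by rewrite -cartan_intE // coroot2.
Qed.

Lemma coroot_norm_gt0 a : is_root a -> 0 < coroot_norm a.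
Proof.
move=> a_root; have a_s : a \in s by rewrite mem_roots.
rewrite /coroot_norm (bigD1_seq a) //= cartan_int_diag //.
by rewrite ltr_wpDr // sumr_ge0 // => c _; apply: sqr_ge0.
Qed.

Lemma sum_cartan_int a b : is_root a -> is_root b ->
  2 * (\sum_(c <- s) cartan_int c a * cartan_int c b) =
  cartan_int a b * coroot_norm a.
Proof.
move=> a_root b_root; apply: (intr_inj (R := K)).
by rewrite !rmorphM /= -kappa_coroot // kappa_coroot_l ?coroot_H // cartan_intE.
Qed.

(** Both sides are twice the Killing form at the two coroots. *)
Lemma cartan_int_sym a b : is_root a -> is_root b ->
  cartan_int a b * coroot_norm a = cartan_int b a * coroot_norm b.
Proof.
move=> a_root b_root; rewrite -!sum_cartan_int //; congr (_ * _).
by apply: eq_bigr => c _; rewrite mulrC.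
Qed.

(* The norm of 2 h_b - <a, b> h_a, a vector orthogonal to h_a. *)
Lemma cartan_int_cauchy a b : is_root a -> is_root b ->
  \sum_(c <- s) (2 * cartan_int c b - cartan_int a b * cartan_int c a) ^+ 2 =
  coroot_norm b * (4 - cartan_int a b * cartan_int b a).
Proof.
move=> a_root b_root; pose n := cartan_int a b.
transitivity (4 * coroot_norm b - 2 * n *
  (2 * \sum_(c <- s) cartan_int c a * cartan_int c b) + n ^+ 2 * coroot_norm a).
  rewrite /coroot_norm !mulr_sumr -sumrN -!big_split /=.
  by apply: eq_bigr => c _; rewrite /n; ring.
have E := cartan_int_sym a_root b_root.
rewrite sum_cartan_int // expr2 -[n * n * _]mulrA [n * coroot_norm a]E /n; ring.
Qed.

(** The sum of squares in [cartan_int_cauchy] bounds the product by 4. Equality makes every square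
    vanish and forces 2 b = m a with m dividing 4, so b is a or -a, or one root is up to sign the
    double of the other. *)
Lemma cartan_int_prod a b : is_root a -> is_root b -> b <> a -> b <> - a ->
  cartan_int a b * cartan_int b a < 4.
Proof.
move=> a_root b_root ba bNa; have C := cartan_int_cauchy a_root b_root.
have kb := coroot_norm_gt0 b_root; have ka := coroot_norm_gt0 a_root.
set m := cartan_int b a in C *; set n := cartan_int a b in C *.
have mn_sym : n * coroot_norm a = m * coroot_norm b := cartan_int_sym a_root b_root.
have nm4 : n * m <= 4.
  have : 0 <= coroot_norm b * (4 - n * m).
    by rewrite -C sumr_ge0 // => c _; apply: sqr_ge0.
  by rewrite pmulr_rge0 // subr_ge0.
rewrite lt_neqAle nm4 andbT; apply/eqP => nm_eq.
have c0 c : is_root c -> 2 * cartan_int c b = n * cartan_int c a.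
  move=> c_root; move: C; rewrite nm_eq subrr mulr0 => /eqP.
  rewrite psumr_eq0 => [/allP/(_ c)|? _]; last exact: sqr_ge0.
  by rewrite mem_roots => /(_ c_root) /=; rewrite sqrf_eq0 subr_eq0 => /eqP.
have b2 : b *+ 2 = m%:~R *: a.
  apply: weight_at_inj => y yH; rewrite weight_atMn weight_atZ.
  have kbK : (coroot_norm b)%:~R != 0 :> K by rewrite intr_eq0 gt_eqF.
  have mnK : m%:~R * (coroot_norm b)%:~R = n%:~R * (coroot_norm a)%:~R :> K.
    by rewrite -!rmorphM /= mn_sym.
  have kappaE : 2 * kappa (coroot b) y = n%:~R * kappa (coroot a) y.
    rewrite !kappa_cartan ?coroot_H // !mulr_sumr; apply: eq_big_seq => c.
    rewrite mem_roots => c_root; rewrite !cartan_intE // !mulrA.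
    by rewrite -[2]/(2%:~R) -!rmorphM /= c0.
  apply: (mulIf kbK); rewrite mulrnAl -kappa_coroot_l // kappaE.
  rewrite mulrAC mnK -mulrA [_ * wt a y]mulrC -kappa_coroot_l //; ring.
have no_double (c : dual H) : is_root c -> is_root (c *+ 2) -> False.
  by move=> c_root; apply/negP/root_double.
have half (c : dual H) : b *+ 2 = c *+ 2 -> b = c.
  rewrite -!scaler_nat; apply: scalerI; by rewrite pnatr_eq0.
rewrite scaler_int in b2.
have := int_factor4 nm_eq; case=> [|[|[|[|[|]]]]] mE; rewrite mE ?mulrNz in b2.
- apply: (no_double a a_root); rewrite -(half (a *+ 2)) // -mulrnA.
  exact: b2.
- by apply: ba; apply: half.
- by apply: (no_double b b_root); rewrite b2 mulr1z.
- by apply: (no_double b b_root); rewrite b2 mulr1z root_opp.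
- by apply: bNa; apply: half; rewrite mulNrn.
- apply: (no_double (- a) (root_opp a_root)); rewrite -(half (- a *+ 2)) //.
  by rewrite -mulrnA mulNrn.
Qed.

(** If b is neither a nor -a, a value above 3 makes the transposed integer positive by symmetry, so
    the product reaches 4. *)
Lemma cartan_int_le3 a b : is_root a -> is_root b -> cartan_int b a <= 3.
Proof.
move=> a_root b_root.
have [->|/eqP ba] := eqVneq b a; first by rewrite cartan_int_diag.
have [->|/eqP bNa] := eqVneq b (- a).
  suff -> : cartan_int (- a) a = - 2 by [].
  apply: (intr_inj (R := K)); rewrite -cartan_intE ?root_opp //.
  by rewrite weight_atN coroot2 // rmorphN.
rewrite leNgt; apply/negP => b_gt3.
have := cartan_int_prod a_root b_root ba bNa.
have sym := cartan_int_sym a_root b_root.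
have : 0 < cartan_int a b.
  rewrite -(pmulr_lgt0 _ (coroot_norm_gt0 a_root)) sym.
  by rewrite pmulr_lgt0 ?coroot_norm_gt0 // (lt_trans _ b_gt3).
by move: b_gt3; move: (cartan_int a b) (cartan_int b a) => n w; nia.
Qed.

(** * Structure constants *)

Lemma kappaDl y z w : kappa (y + z) w = kappa y w + kappa z w.
Proof. by rewrite -big_split; apply: eq_bigr => i _; rewrite lieDl linearD. Qed.

Lemma kappaZl c y z : kappa (c *: y) z = c * kappa y z.
Proof. by rewrite mulr_sumr; apply: eq_bigr => i _; rewrite lieZl linearZ. Qed.

(** By [chev_opp], [[x_a, x_b], [x_(-a), x_(-b)]] is -c^2 times the coroot of a + b; the Leibniz
    rule expands the same bracket through the two strings. *)
Lemma coroot_relation a b c (r q r' q' : nat) :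
  is_root a -> is_root b -> is_root (a + b) ->
  lie (x a) (x b) = c *: x (a + b) ->
  lie (x (- a)) (lie (x a) (x b)) = (q * r.+1)%:R *: x b ->
  lie (x (- b)) (lie (x b) (x a)) = (q' * r'.+1)%:R *: x a ->
  c ^+ 2 *: coroot (a + b) =
    (q * r.+1)%:R *: coroot b + (q' * r'.+1)%:R *: coroot a.
Proof.
move=> a_root b_root ab_root cE aE bE.
have [c' c'E c'NE] := chev_opp xh_chevalley a_root b_root ab_root.
have cc' : c' = c.
  apply/eqP; move: c'E; rewrite cE => /eqP.
  by rewrite -subr_eq0 -scalerBl scaler_eq0 (negPf (x_neq0 ab_root)) orbF
    subr_eq0 eq_sym.
rewrite {}cc' in c'NE.
have E : lie (lie (x a) (x b)) (lie (x (- a)) (x (- b))) =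
    - c ^+ 2 *: coroot (a + b).
  by rewrite cE c'NE lieZl lieZr scalerA mulrN -expr2.
have {}bE : lie (lie (x a) (x b)) (x (- b)) = (q' * r'.+1)%:R *: x a.
  by rewrite lieC (lieC (x a)) lieNr bE opprK.
have {}aE : lie (lie (x a) (x b)) (x (- a)) = - ((q * r.+1)%:R *: x b).
  by rewrite lieC aE.
apply: oppr_inj; rewrite -scaleNr -E lie_leibniz aE bE lieNl lieZl lieZr.
by rewrite (lieC (x (- a))) scalerN -opprD.
Qed.

Lemma structure_constant_int a b c :
  is_root a -> is_root b -> is_root (a + b) ->
  lie (x a) (x b) = c *: x (a + b) -> exists k : int, c = k%:~R.
Proof.
move=> a_root b_root ab_root cE.
have [r [q [mE top_root qE _]]] := root_string a_root b_root.
have [r' [q' [_ _ q'E _]]] := root_string b_root a_root.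
have rel := coroot_relation a_root b_root ab_root cE qE q'E.
have ba : b <> a.
  by move=> ba; move: ab_root; rewrite ba -mulr2n; apply/negP/root_double.
have bNa : b <> - a.
  by move=> bE; have := root_neq0 ab_root; rewrite bE subrr eqxx.
have aba : a + b <> a.
  by move=> /eqP; rewrite -subr_eq0 addrC addKr (negPf (root_neq0 b_root)).
have abNa : a + b <> - a.
  move=> /(congr1 (fun c => - a + c)); rewrite addKr -opprD -mulr2n => bE.
  move: (root_opp b_root); rewrite bE opprK; exact/negP/root_double.
pose m := cartan_int b a; pose n := cartan_int a b.
have nm4 : n * m < 4 := cartan_int_prod a_root b_root ba bNa.
have wm : wt b (coroot a) = m%:~R by rewrite cartan_intE.
have wn : wt a (coroot b) = n%:~R by rewrite cartan_intE.
have nmK : (4 - n * m)%:~R != 0 :> K by rewrite intr_eq0 subr_eq0 gt_eqF.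
(* a vanishes at z and b does not, so pairing rel with z isolates h_b *)
pose z := 2 *: coroot b - n%:~R *: coroot a.
have zH : z \in H by rewrite memvB // memvZ // coroot_H.
have wzE e : wt e z = 2 * wt e (coroot b) - n%:~R * wt e (coroot a).
  by rewrite -!weight_at_scale -linearB.
have wza : wt a z = 0 by rewrite wzE wn coroot2 // mulrC subrr.
have wzb : wt b z = (4 - n * m)%:~R.
  by rewrite wzE wm coroot2 // rmorphB rmorphM /=; congr (_ - _); ring.
have c2E : c ^+ 2 * (coroot_norm (a + b))%:~R =
    (q * r.+1)%:R * (coroot_norm b)%:~R.
  apply: (mulIf nmK).
  have := congr1 (fun y => kappa y z) rel; rewrite /= kappaDl !kappaZl => E0.
  have : c ^+ 2 * (2 * kappa (coroot (a + b)) z) =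
      (q * r.+1)%:R * (2 * kappa (coroot b) z) +
      (q' * r'.+1)%:R * (2 * kappa (coroot a) z).
    by rewrite mulrCA E0; ring.
  rewrite !kappa_coroot_l // weight_atD wza wzb add0r mul0r mulr0 addr0 => E.
  by rewrite -mulrA [_ * (4 - _)%:~R]mulrC E; ring.
have kab := coroot_norm_gt0 ab_root.
have kabK : (coroot_norm (a + b))%:~R != 0 :> K by rewrite intr_eq0 gt_eqF.
(* For q = 0 the relation [c2E] already forces c = 0. *)
have [q0|q_gt0] := posnP q.
  exists 0; move/eqP: c2E; rewrite q0 mul0n mul0r mulf_eq0 (negPf kabK) orbF.
  by rewrite sqrf_eq0 => /eqP.
have mE' : m = r%:Z - q%:Z.
  by apply: (intr_inj (R := K)); rewrite -wm mE rmorphB.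
have wD e : is_root e -> cartan_int (a + b) e = cartan_int a e + cartan_int b e.
  move=> e_root; apply: (intr_inj (R := K)).
  by rewrite rmorphD /= -!cartan_intE // weight_atD.
(* The top b + q a of the string is a root, so the bound 3 applies to its Cartan integer and hence
   to m + 2q. *)
have topE : cartan_int (b + a *+ q) a = m + 2 * q%:Z.
  apply: (intr_inj (R := K)); rewrite -cartan_intE // weight_atD weight_atMn.
  by rewrite coroot2 // wm; ring.
have le3 : m + 2 * q%:Z <= 3 by rewrite -topE cartan_int_le3.
have rq : r.+1%:Z * coroot_norm (a + b) = q%:Z * coroot_norm b.
  apply: (@string_length_int r q m n (cartan_int a (a + b)) (cartan_int b (a + b))
    _ (coroot_norm a)) => //; rewrite ?coroot_norm_gt0 //.
  - exact: cartan_int_sym.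
  - by rewrite -cartan_int_sym // wD // cartan_int_diag.
  - by rewrite -[RHS]cartan_int_sym // wD // cartan_int_diag.
  - by rewrite -wD // cartan_int_diag.
  - have -> : 2 + m = cartan_int (a + b) a by rewrite wD // cartan_int_diag.
    exact: cartan_int_prod.
have c2 : c ^+ 2 = r.+1%:R ^+ 2.
  apply: (mulIf kabK); rewrite c2E expr2 -mulrA.
  have -> : r.+1%:R * (coroot_norm (a + b))%:~R = q%:R * (coroot_norm b)%:~R :> K.
    by have /(congr1 (fun z : int => z%:~R : K)) := rq; rewrite !rmorphM.
  by rewrite natrM mulrA [q%:R * _]mulrC.
have /eqP := c2; rewrite eqf_sqr => /orP[] /eqP ->.
  by exists r.+1%:Z.
by exists (- r.+1%:Z); rewrite rmorphN.
Qed.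

(** * Rationality of coordinates *)

Definition rational_coords v :=
  forall k : 'I_N, exists q : rat, coord X k v = ratr q.

Lemma rational_coords0 : rational_coords 0.
Proof. by move=> k; exists 0; rewrite linear0 rmorph0. Qed.

Lemma rational_coordsD u v :
  rational_coords u -> rational_coords v -> rational_coords (u + v).
Proof.
move=> uq vq k; have [[q qE] [r rE]] := (uq k, vq k).
by exists (q + r); rewrite linearD /= qE rE rmorphD.
Qed.

Lemma rational_coordsZ q v :
  rational_coords v -> rational_coords (ratr q *: v).
Proof.
move=> vq k; have [r rE] := vq k.
by exists (q * r); rewrite linearZ /= rE rmorphM.
Qed.

Lemma rational_coordsN v : rational_coords v -> rational_coords (- v).
Proof.
by move=> vq k; have [r rE] := vq k; exists (- r); rewrite linearN /= rE rmorphN.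
Qed.

Lemma x_in_basis a : is_root a -> exists i : 'I_N, X`_i = x a.
Proof.
move=> a_root; have /(nthP 0)[i iN iE] : x a \in xhs.
  by rewrite mem_cat map_f // mem_roots.
by exists (Ordinal iN).
Qed.

Lemma rational_basis v : v \in xhs -> rational_coords v.
Proof.
move=> /(nthP 0)[j jN <-] k; exists (Ordinal jN == k)%:R.
by rewrite rmorph_nat; apply: (coord_free (Ordinal jN) k X_free).
Qed.

Lemma rational_x a : is_root a -> rational_coords (x a).
Proof.
move=> a_root; apply: rational_basis; rewrite mem_cat map_f //.
by rewrite mem_roots.
Qed.

Lemma rational_h i : rational_coords (h i).
Proof. by apply: rational_basis; rewrite mem_cat orbC fintype.image_f. Qed.

(** The coordinates of h_a in the [h i] solve a linear system whose matrix is the Cartan matrix and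
    whose right side is integral. The matrix is invertible, so the solution is rational. *)
Lemma rational_coroot a : is_root a -> rational_coords (coroot a).
Proof.
move=> a_root; pose n := #|I|.
pose hX : n.-tuple g := image_tuple h I.
pose aX : n.-tuple (dual H) := image_tuple alpha I.
have hXE (i : 'I_n) : hX`_i = h (enum_val i) by apply: nth_image.
have aXE (i : 'I_n) : aX`_i = alpha (enum_val i) by apply: nth_image.
have alpha_root i : is_root (alpha i) by have [+ _ _] := alpha_simple; apply.
pose C : 'M[rat]_n := \matrix_(i, j)
  (cartan_int (alpha (enum_val i)) (alpha (enum_val j)))%:~R.
pose D := \col_j coord hX j (coroot a) : 'cV[K]_n.
pose v := \col_i (cartan_int (alpha (enum_val i)) a)%:~R : 'cV[rat]_n.
have aD : coroot a = \sum_(j < n) D j 0 *: h (enum_val j).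
  have : coroot a \in <<hX>>%VS by rewrite -cartan_span coroot_H.
  by move/coord_span => {1}->; apply: eq_bigr => j _; rewrite hXE mxE.
have CE i j : (map_mx ratr C : 'M[K]_n) i j =
    wt (alpha (enum_val i)) (h (enum_val j)).
  by rewrite !mxE ratr_int h_coroot (cartan_intE (alpha_root _) (alpha_root _)).
have CD : map_mx ratr C *m D = map_mx ratr v.
  apply/colP => i.
  rewrite !mxE ratr_int -(cartan_intE a_root (alpha_root _)) aD.
  rewrite weight_at_sumr; apply: eq_bigr => j _.
  by rewrite CE weight_at_scale mulrC.
(* A row killed by the matrix is a combination of simple roots vanishing at every [h i], hence on
   [H], hence trivial. *)
have C_unit : (map_mx ratr C : 'M[K]_n) \in unitmx.
  rewrite -row_free_unit; apply: inj_row_free => u uC.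
  have alpha_free : free aX.
    by have [_ /basis_free + _] := alpha_simple.
  apply/rowP => i; rewrite mxE; move: i.
  suff /(freeP alpha_free (fun i => u 0 i)) :
    \sum_(i < n) u 0 i *: aX`_i = 0 by [].
  apply: weight_at_inj => y yH; rewrite weight_at0 weight_at_suml.
  have {}yH : y \in <<hX>>%VS by rewrite -cartan_span.
  rewrite (coord_span yH).
  under eq_bigr do rewrite weight_atZ weight_at_sumr mulr_sumr.
  rewrite exchange_big big1 // => j _.
  transitivity (coord hX j y * (u *m map_mx ratr C) 0 j).
    rewrite mxE mulr_sumr; apply: eq_bigr => i _.
    by rewrite CE weight_at_scale aXE hXE mulrCA.
  by rewrite uC mxE mulr0.
have -> : coroot a = \sum_(j < n) ratr ((invmx C *m v) j 0) *: h (enum_val j).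
  rewrite [LHS]aD; apply: eq_bigr => j _; congr (_ *: _).
  by rewrite -[D](mulKmx C_unit) CD -map_invmx -map_mxM [LHS]mxE.
elim/big_ind: _ => [||j _]; first exact: rational_coords0.
  exact: rational_coordsD.
exact/rational_coordsZ/rational_h.
Qed.

Lemma rational_coordsZ_int (k : int) v :
  rational_coords v -> rational_coords (k%:~R *: v).
Proof. by rewrite -(ratr_int K k); apply: rational_coordsZ. Qed.

Lemma rational_lie_xx a b : is_root a -> is_root b ->
  rational_coords (lie (x a) (x b)).
Proof.
move=> a_root b_root.
have ab_in := lie_root_space (x_root a_root) (x_root b_root).
have [ab0|ab_neq0] := eqVneq (a + b) 0.
  have -> : b = - a by apply/eqP; rewrite -addr_eq0 addrC ab0.
  exact: rational_coroot a_root.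
have [->|lie_neq0] := eqVneq (lie (x a) (x b)) 0; first exact: rational_coords0.
have ab_root := root_space_neq0 ab_in lie_neq0 ab_neq0.
have [c cE] := root_space_line ab_root ab_in.
have [k kE] := structure_constant_int a_root b_root ab_root cE.
by rewrite cE kE; apply: rational_coordsZ_int; apply: rational_x.
Qed.

Lemma rational_lie_hx i b : is_root b -> rational_coords (lie (h i) (x b)).
Proof.
move=> b_root; have i_root : is_root (alpha i).
  by have [+ _ _] := alpha_simple; apply.
rewrite h_coroot (lie_weight (x_root b_root) (coroot_H i_root)).
rewrite (cartan_intE i_root b_root).
by apply: rational_coordsZ_int; apply: rational_x.
Qed.

Lemma rational_lie_basis (i j : 'I_N) : rational_coords (lie X`_i X`_j).
Proof.
have basis_cases (k : 'I_N) : (exists2 a, is_root a & X`_k = x a) \/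
    exists l, X`_k = h l.
  have : X`_k \in xhs by apply: mem_nth.
  rewrite mem_cat => /orP[/mapP[a]|/mapP[l _ ->]]; last by right; exists l.
  by rewrite mem_roots => a_root ->; left; exists a.
have h_H l : h l \in H by apply: coroot_in (chev_simple_coroot xh_chevalley l).
have [[a a_root ->]|[k ->]] := basis_cases i;
  have [[b b_root ->]|[l ->]] := basis_cases j.
- exact: rational_lie_xx.
- by rewrite lieC; apply/rational_coordsN/rational_lie_hx.
- exact: rational_lie_hx.
- by rewrite (cartan_abelian _ (h_H k)); apply: rational_coords0.
Qed.

End ChevalleyBasis.

(** * The integral form attached to a Chevalley basis *)

Theorem chevalley_integral_form (K : numFieldType)
    (g : finLieType K) (H : {vspace g})
    (I : finType) (alpha : I -> dual H) (alpha_simple : simple_roots alpha)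
    (x : dual H -> g) (h : I -> g) (xh_chevalley : chevalley_basis alpha x h)
    (A : comAlgType K) (B : set A) (B_basis : basis_set B)
    (B_mul : forall a b : A, B a -> B b -> B (a * b))
    (L : lieType K) (t : {bilinear g -> A -> L}) (L_map : is_map_algebra t)
    (U : algType K) (iota : {linear L -> U})
    (U_env : is_enveloping_algebra iota) :
  is_integral_form
    (val : gen_subring_type (divided_power_generators alpha x B t iota) -> U).
Proof.
have [s [s_uniq sE xh_basis]] := chev_basis xh_chevalley.
set G := divided_power_generators alpha x B t iota.
have [alpha_root _ alpha_sign] := alpha_simple.
have xG a b : is_root a -> B b -> iota (t (x a) b) \in gen_subring G.
  move=> a_root Bb; apply/asboolP => S _; apply; rewrite /G.
  (* The element itself is its divided power with r = 1; a negative root is reached through the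
     positive root -a. *)
  have xE : iota (t (x a) b) = divided_power (iota (t (x a) b)) 1.
    by rewrite /divided_power invr1 scale1r expr1.
  have [a_pos|a_neg] := alpha_sign a a_root.
    by exists a, b, 1%N; split; [split|exact: Bb|left].
  exists (- a), b, 1%N; split; [|exact: Bb|by right; rewrite opprK].
  by split; [exact: (root_opp xh_chevalley a_root)|exact: a_neg].
have hG i b : B b -> iota (t (h i) b) \in gen_subring G.
  (* With b = b1 b2, the element h_i (x) b is the bracket of x_(alpha_i) (x) b1 and x_(-alpha_i) (x)
     b2, so its image is a commutator in the subring. *)
  move=> Bb; have [b1 [b2 [Bb1 Bb2 ->]]] := basis_set_factor B_basis B_mul Bb.
  rewrite (h_coroot alpha_simple xh_chevalley s_uniq sE xh_basis) -L_map.2.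
  have xi := xG _ _ (alpha_root i).
  have xNi := xG _ _ (root_opp xh_chevalley (alpha_root i)).
  by rewrite U_env.1 rpredB // rpredM // ?xi ?xNi.
apply: (@integral_form_of_rational_basis _ _ _ (in_tuple _) xh_basis _ _ _
  B_basis B_mul _ _ L_map _ _ U_env G).
- exact: (rational_lie_basis alpha_simple xh_chevalley s_uniq sE xh_basis).
- move=> i b Bb; have : (in_tuple _)`_i \in _ := mem_nth 0 (ltn_ord i).
  rewrite mem_cat => /orP[/mapP[a a_s ->]|/mapP[k _ ->]]; last exact: hG.
  by apply: xG; rewrite -?(mem_roots sE).
- move=> u [a [b [r [[a_root _] Bb uE]]]].
  have xX := @x_in_basis _ _ _ _ x h s sE.
  case: uE => ->.
    by have [i iE] := xX a a_root; exists i, b, r; rewrite iE.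
  have [i iE] := xX (- a) (root_opp xh_chevalley a_root).
  by exists i, b, r; rewrite iE.
Qed.

Theorem mainTheorem2 (R : realType)
    (g : finLieType R[i]) (g_simple : simple_lie g)
    (H : {vspace g}) (H_cartan : cartan_subalgebra H)
    (I : finType) (alpha : I -> dual H) (alpha_simple : simple_roots alpha)
    (x : dual H -> g) (h : I -> g) (xh_chevalley : chevalley_basis alpha x h)
    (A : comAlgType R[i])
    (B : set A) (B_basis : basis_set B)
    (B_mul : forall a b : A, B a -> B b -> B (a * b))
    (L : lieType R[i]) (t : {bilinear g -> A -> L}) (L_map : is_map_algebra t)
    (U : algType R[i]) (iota : {linear L -> U})
    (U_env : is_enveloping_algebra iota) :
  is_integral_form
    (val : gen_subring_type (divided_power_generators alpha x B t iota) -> U).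
Proof.
exact: (chevalley_integral_form alpha_simple xh_chevalley B_basis B_mul L_map
  U_env).
Qed.
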